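(* Let $\mathcal{X}$ be a Hilbert module over a pro-$C^*$-algebra $\mathcal{A}$, let $K\in Hom^*_{\mathcal{A}}(\mathcal{X})$ be uniformly bounded with $Ran(K)$ dense in $\mathcal{X}$, let $\{\xi_i\}_{i\in I}$ be a $K$-frame for $\mathcal{X}$, and let $T\in Hom^*_{\mathcal{A}}(\mathcal{X})$ be uniformly bounded with closed range. If $\{T\xi_i\}_{i\in I}$ and $\{T^*\xi_i\}_{i\in I}$ are $K$-frames for $\mathcal{X}$, then $T$ is invertible.
   Context: A pro-$C^*$-algebra $\mathcal{A}$ is a complete Hausdorff topological $*$-algebra whose topology is given by its continuous $C^*$-seminorms $S(\mathcal{A})$. A Hilbert $\mathcal{A}$-module $\mathcal{X}$ is a left $\mathcal{A}$-module with an $\mathcal{A}$-valued inner product, complete for $\bar p_{\mathcal{X}}(\xi)=\sqrt{p(\langle\xi,\xi\rangle)}$. $Hom^*_{\mathcal{A}}(\mathcal{X})$ denotes adjointable bounded $\mathcal{A}$-module maps; $T$ is uniformly bounded if there is a single $C>0$ with $\bar p_{\mathcal{X}}(T\xi)\le C\bar p_{\mathcal{X}}(\xi)$ for all $p,\xi$. A sequence $\{\xi_i\}_{i\in I}$ ($I$ countable) is a $K$-frame for $\mathcal{X}$ if $\sum_i\langle\xi,\xi_i\rangle\langle\xi_i,\xi\rangle$ converges in $\mathcal{A}$ and there are $A,B>0$ with $A\langle K^*\xi,K^*\xi\rangle\le\sum_i\langle\xi,\xi_i\rangle\langle\xi_i,\xi\rangle\le B\langle\xi,\xi\rangle$ for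 all $\xi\in\mathcal{X}$. *)

(* Defs.v *)
From HB Require Import structures.
From mathcomp Require Import all_boot all_order all_algebra.
From mathcomp Require Import complex.
From mathcomp Require Import boolp classical_sets filter reals.
Set Implicit Arguments. Unset Strict Implicit. Unset Printing Implicit Defensive.
Import Order.TTheory GRing.Theory Num.Theory.
Local Open Scope ring_scope.
Local Open Scope classical_set_scope.

Section ProC.
Variable R : realType.
Local Notation C := (R[i]).

(* A (possibly non-unital) complex *-algebra is modelled as an lmodType over C
   together with an explicit bilinear associative product and an involution. *)
Record is_star_algebra (A : lmodType C) (mul : A -> A -> A) (star : A -> A)
  : Prop := {
  mulA : forall a b c, mul a (mul b c) = mul (mul a b) c;
  mulDl : forall a b c, mul (a + b) c = mul a c + mul b c;
  mulDr : forall a b c, mul a (b + c) = mul a b + mul a c;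
  mulZl : forall (k : C) a b, mul (k *: a) b = k *: mul a b;
  mulZr : forall (k : C) a b, mul a (k *: b) = k *: mul a b;
  starK : forall a, star (star a) = a;
  starD : forall a b, star (a + b) = star a + star b;
  starZ : forall (k : C) a, star (k *: a) = k^* *: star a;
  starM : forall a b, star (mul a b) = mul (star b) (star a)
}.

Record is_Cstar_seminorm (A : lmodType C) (mul : A -> A -> A) (star : A -> A)
  (p : A -> R) : Prop := {
  sn_ge0 : forall a, 0 <= p a;
  sn_triangle : forall a b, p (a + b) <= p a + p b;
  sn_homog : forall (k : C) a, ((p (k *: a))%:C = `|k| * (p a)%:C)%C;
  sn_submul : forall a b, p (mul a b) <= p a * p b;
  sn_Cstar : forall a, p (mul (star a) a) = p a ^+ 2
}.

(* A seminorm q is continuous for the locally convex topology generated by the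
   family S iff it is dominated by a multiple of a finite sum of members of S. *)
Definition sn_continuous {T : Type} (S : set (T -> R)) (q : T -> R) : Prop :=
  exists (n : nat) (ps : 'I_n -> T -> R), (forall i, S (ps i)) /\
    exists2 c : R, 0 < c & forall a, q a <= c * \sum_(i < n) ps i a.

Definition sn_complete {T : zmodType} (N : set (T -> R)) : Prop :=
  forall F : set_system T, ProperFilter F ->
    (forall p, N p -> forall e : R, 0 < e ->
       exists2 U, F U & forall x y, U x -> U y -> p (x - y) < e) ->
    exists l : T, forall p, N p -> forall e : R, 0 < e ->
       exists2 U, F U & forall x, U x -> p (x - l) < e.

(* (A, mul, star) is a pro-C*-algebra whose set of continuous C*-seminorms
   S(A) is exactly S: the topology is the one generated by S, every member of
   S is a C*-seminorm, and every C*-seminorm continuous for that topology is in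
   S. The topology is Hausdorff and complete. *)
Record is_proC (A : lmodType C) (mul : A -> A -> A) (star : A -> A)
  (S : set (A -> R)) : Prop := {
  proC_alg : is_star_algebra mul star;
  proC_sn : forall p, S p -> is_Cstar_seminorm mul star p;
  proC_all : forall q, is_Cstar_seminorm mul star q -> sn_continuous S q -> S q;
  proC_sep : forall a, (forall p, S p -> p a = 0) -> a = 0;
  proC_complete : sn_complete S
}.

Definition Apos {A : lmodType C} (mul : A -> A -> A) (star : A -> A) (a : A)
  : Prop := exists b, a = mul (star b) b.
Definition Ale {A : lmodType C} (mul : A -> A -> A) (star : A -> A) (a b : A)
  : Prop := Apos mul star (b - a).

Definition series_to {A : lmodType C} (S : set (A -> R)) (u : nat -> A) (l : A)
  : Prop :=
  forall p, S p -> forall e : R, 0 < e ->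
    exists N : nat, forall n, (N <= n)%N -> p (\sum_(i < n) u i - l) < e.

Record is_hilbert_module (A : lmodType C) (mul : A -> A -> A) (star : A -> A)
  (S : set (A -> R)) (X : lmodType C) (act : A -> X -> X) (ip : X -> X -> A)
  : Prop := {
  actM : forall a b x, act (mul a b) x = act a (act b x);
  actDl : forall a b x, act (a + b) x = act a x + act b x;
  actDr : forall a x y, act a (x + y) = act a x + act a y;
  actZl : forall (k : C) a x, act (k *: a) x = k *: act a x;
  actZr : forall (k : C) a x, act a (k *: x) = k *: act a x;
  ipDl : forall x y z, ip (x + y) z = ip x z + ip y z;
  ipZl : forall (k : C) x y, ip (k *: x) y = k *: ip x y;
  ipAl : forall a x y, ip (act a x) y = mul a (ip x y);
  ip_star : forall x y, ip y x = star (ip x y);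
  ip_pos : forall x, Apos mul star (ip x x);
  ip_def : forall x, ip x x = 0 -> x = 0;
  hm_complete :
    sn_complete [set q | exists2 p, S p & q = fun x => Num.sqrt (p (ip x x))]
}.

Definition pbar {A X : Type} (ip : X -> X -> A) (p : A -> R) (x : X) : R :=
  Num.sqrt (p (ip x x)).

Definition in_closure {A : Type} {X : lmodType C} (S : set (A -> R))
  (ip : X -> X -> A) (E : set X) (x : X) : Prop :=
  forall (n : nat) (ps : 'I_n -> A -> R), (forall i, S (ps i)) ->
    forall e : R, 0 < e ->
      exists2 y, E y & forall i, pbar ip (ps i) (x - y) < e.

Definition closed_range {A : Type} {X : lmodType C} (S : set (A -> R))
  (ip : X -> X -> A) (T : X -> X) : Prop :=
  forall x, in_closure S ip (range T) x -> range T x.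

Definition dense_range {A : Type} {X : lmodType C} (S : set (A -> R))
  (ip : X -> X -> A) (T : X -> X) : Prop :=
  forall x, in_closure S ip (range T) x.

Definition is_adjoint {A X : Type} (ip : X -> X -> A) (T Tadj : X -> X) : Prop :=
  forall x y, ip (T x) y = ip x (Tadj y).

Definition in_Hom_star {A : Type} {X : lmodType C} (S : set (A -> R))
  (act : A -> X -> X) (ip : X -> X -> A) (T : X -> X) : Prop :=
  [/\ forall x y, T (x + y) = T x + T y,
      forall (k : C) x, T (k *: x) = k *: T x,
      forall a x, T (act a x) = act a (T x),
      exists Tadj, is_adjoint ip T Tadj &
      forall p, S p -> exists2 c : R, 0 <= c &
        forall x, pbar ip p (T x) <= c * pbar ip p x].

Definition unif_bounded {A : Type} {X : lmodType C} (S : set (A -> R))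
  (ip : X -> X -> A) (T : X -> X) : Prop :=
  exists2 c : R, 0 < c & forall p, S p -> forall x,
    pbar ip p (T x) <= c * pbar ip p x.

Definition K_frame {A : lmodType C} {X : lmodType C} (mul : A -> A -> A)
  (star : A -> A) (S : set (A -> R)) (ip : X -> X -> A) (Kadj : X -> X)
  (xi : nat -> X) : Prop :=
  (forall x, exists l, series_to S (fun i => mul (ip x (xi i)) (ip (xi i) x)) l)
  /\ exists (a b : R), [/\ 0 < a, 0 < b &
    forall x l, series_to S (fun i => mul (ip x (xi i)) (ip (xi i) x)) l ->
      Ale mul star ((a%:C)%C *: ip (Kadj x) (Kadj x)) l /\
      Ale mul star l ((b%:C)%C *: ip x x)].

End ProC.

(* Main.v *)
Require Import Defs.
From HB Require Import structures.
From Stdlib Require Ncring Ncring_tac.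
From mathcomp Require Import all_boot all_order all_algebra.
From mathcomp Require Import complex lra ring.
From mathcomp Require Import boolp classical_sets filter reals.
Set Implicit Arguments. Unset Strict Implicit. Unset Printing Implicit Defensive.
Import Order.TTheory GRing.Theory Num.Theory.
Local Open Scope ring_scope.
Local Open Scope classical_set_scope.

(* Write |.|_p for the seminorm that a C*-seminorm p induces on the module X.

   Comparing the frame operators of xi and of T xi gives |K* x|_p <= c |T* x|_p,
   and likewise |K* x|_p <= c |T x|_p. If D = 1 - T T* / |T|^2 then
   |T* D^n|_p -> 0, hence |D^n K|_p = |K* D^n|_p -> 0; as K y - D^n K y lies in
   the range of T and K has dense range, T has dense range. Being closed, the
   range of T is X. By the same argument T* has dense range.

   The open mapping theorem is not available for X, so that T is bounded below
   for each p is shown by a gliding hump: if |x|_p were large and |T x|_p small,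
   then x' = e (e + a)^-1 x with a = <T x, T x> would have |x'|_p large and
   |T x'|_q <= sqrt e for all q at once, and the sum of a suitable series of such
   vectors T x' could not lie in the range of T. Finally T* is bounded below
   because T is onto, so it is onto as well, which provides the adjoint of the
   inverse of T.

   The C*-theory behind this (monotonicity of p on positive elements, the
   Cauchy-Schwarz inequality, positivity of T* T) is derived for one C*-seminorm
   at a time and without completeness, replacing continuous functional calculus
   by approximate square roots obtained from Newton's iteration. *)

(** * Normalisation of identities in noncommutative rings *)

#[local] Instance nc_ops (W : pzRingType) :
  @Ncring.Ring_ops W 0 1 +%R *%R (fun x y => x - y) -%R eq := {}.

#[local] Instance nc_ring (W : pzRingType) : Ncring.Ring (Ro := nc_ops W).
Proof.
constructor; try exact _; rewrite ?/(Algebra_syntax.equality _ _) /=.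
- exact: add0r.
- exact: addrC.
- exact: addrA.
- exact: mul1r.
- exact: mulr1.
- exact: mulrA.
- exact: mulrDl.
- by move=> *; exact: mulrDr.
- by [].
- exact: subrr.
Qed.

Ltac ncring :=
  lazymatch goal with
  | |- @eq ?T ?a ?b => change (@Algebra_syntax.equality T (@eq T) a b)
  end; Ncring_tac.non_commutative_ring.

(** * Elementary inequalities between real numbers *)

Lemma le_eps (R : realFieldType) (a b : R) :
  (forall e : R, 0 < e -> a <= b + e) -> a <= b.
Proof.
move=> h; rewrite leNgt; apply/negP => lt_ba.
by have := h ((a - b) / 2); lra.
Qed.

Lemma ler_of_sqr (R : realDomainType) (a b : R) :
  0 <= b -> a ^+ 2 <= b ^+ 2 -> a <= b.
Proof.
move=> b0 h; rewrite leNgt; apply/negP => lt_ba; nra.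
Qed.

Lemma bernoulli (R : realDomainType) (t : R) n :
  0 <= t -> 1 + n%:R * t <= (1 + t) ^+ n.
Proof.
move=> t0; elim: n => [|n ih]; first by rewrite mul0r addr0.
rewrite exprS -natr1 mulrDl mul1r.
have : 0 <= n%:R * t by rewrite mulr_ge0.
by move: (n%:R * t) ((1 + t) ^+ n) ih => x y *; nra.
Qed.

(** A linear factor cannot make up for a gap between exponentials. This is the spectral radius
    argument, along exponents that are powers of two. *)
Lemma ler_of_pow2 (R : realType) (x r : R) : 0 <= r ->
  (forall k, x ^+ (2 ^ k)%N <= (1 + (2 ^ k)%N%:R) * r ^+ (2 ^ k)%N) -> x <= r.
Proof.
move=> r0 h; rewrite leNgt; apply/negP => lt_rx.
have rp : 0 < r.
  rewrite lt_neqAle r0 andbT eq_sym; apply/eqP => r_eq0.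
  by move: (h 0%N) lt_rx; rewrite r_eq0 !expr1 mulr0; lra.
have t0 : 0 < x / r - 1 by rewrite subr_gt0 ltr_pdivlMr // mul1r.
pose t := x / r - 1; have yE : x / r = 1 + t by rewrite /t; ring.
pose m := Num.bound (2 / t ^+ 2).
have hm : 2 < (2 ^ m)%N%:R * t ^+ 2.
  rewrite -ltr_pdivrMr ?exprn_gt0 //.
  apply: (@lt_trans _ _ m%:R); last by rewrite ltr_nat ltn_expl.
  by apply: archi_boundP; rewrite divr_ge0 // exprn_ge0 // ltW.
(* With [M = 2 ^ m], the exponent [2 * M] makes the left side a square; Bernoulli bounds it below by
   [(1 + M * t) ^+ 2], which exceeds [1 + 2 * M] since [M * t ^+ 2 > 2]. *)
have := h m.+1; rewrite -ler_pdivrMr ?exprn_gt0 // -expr_div_n yE expnS mulnC.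
rewrite exprM natrM.
have := bernoulli (2 ^ m)%N (ltW t0); rewrite -/t.
move: hm; move: ((2 ^ m)%N%:R : R) (ler0n R (2 ^ m)%N) ((1 + t) ^+ _) => M M0 y.
have tp : 0 < t by [].
move: t tp {t0 yE m} => t tp h1 h2 h3.
have : (1 + M * t) ^+ 2 <= y ^+ 2.
  by rewrite ler_pXn2r // nnegrE; nra.
by nra.
Qed.

(** * Pre-C*-algebras *)

(* The complex scalars are given by the real ones [sc] and the central unit [im];
   the C*-seminorm [nu] is not assumed complete. *)
Record is_pre_cstar (R : realType) (W : pzRingType) (sc : {rmorphism R -> W})
  (im : W) (star : W -> W) (nu : W -> R) : Prop := {
  sc_comm : forall t a, sc t * a = a * sc t;
  im_comm : forall a, im * a = a * im;
  im_sqr : im * im = -1;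
  wstarD : forall a b, star (a + b) = star a + star b;
  wstarM : forall a b, star (a * b) = star b * star a;
  wstarK : forall a, star (star a) = a;
  wstar_sc : forall t, star (sc t) = sc t;
  wstar_im : star im = - im;
  nu_ge0 : forall a, 0 <= nu a;
  nuD : forall a b, nu (a + b) <= nu a + nu b;
  nuM : forall a b, nu (a * b) <= nu a * nu b;
  nu_sc : forall t, nu (sc t) <= `|t|;
  nu_im : nu im <= 1;
  nuC : forall a, nu a ^+ 2 <= nu (star a * a)
}.

Section PreCstar.
Variables (R : realType) (W : pzRingType) (sc : {rmorphism R -> W}).
Variables (im : W) (star : W -> W) (nu : W -> R).
Hypothesis CW : is_pre_cstar sc im star nu.
Implicit Types (a b g h v w : W) (s t d e : R).

Lemma wstar0 : star 0 = 0.
Proof. by apply: (addrI (star 0)); rewrite -(wstarD CW) !addr0. Qed.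

Lemma wstarN a : star (- a) = - star a.
Proof. by apply: (addrI (star a)); rewrite -(wstarD CW) !subrr wstar0. Qed.

Lemma wstarB a b : star (a - b) = star a - star b.
Proof. by rewrite (wstarD CW) wstarN. Qed.

Lemma wstar1 : star 1 = 1.
Proof. by rewrite -(rmorph1 sc) (wstar_sc CW). Qed.

Lemma nu1 : nu 1 <= 1.
Proof. by have := nu_sc CW 1; rewrite rmorph1 normr1. Qed.

Lemma nuN a : nu (- a) = nu a.
Proof.
suff h b : nu (- b) <= nu b by apply/le_anti/andP; split=> //; rewrite -{1}[a]opprK.
have := nuM CW (- 1) b; rewrite mulN1r.
have := nu_sc CW (- 1); rewrite rmorphN1 normrN1 => h1 h2.
by apply: (le_trans h2); have := nu_ge0 CW b; nra.
Qed.

Lemma nuB a b : nu (a - b) <= nu a + nu b.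
Proof. by rewrite -(nuN b) (nuD CW). Qed.

Lemma nuBC a b : nu (a - b) = nu (b - a).
Proof. by rewrite -nuN opprB. Qed.

Lemma nu_star a : nu (star a) = nu a.
Proof.
suff h b : nu b <= nu (star b) 
  by apply/le_anti/andP; split=> //; rewrite -{2}[a](wstarK CW).
have := nuC CW b; have := nuM CW (star b) b.
have := nu_ge0 CW b; have := nu_ge0 CW (star b).
by move: (nu b) (nu (star b)) (nu _) => x y z *; nra.
Qed.

Lemma nuZ t a : 0 <= t -> nu (sc t * a) <= t * nu a.
Proof.
move=> t0; apply: (le_trans (nuM CW _ _)).
by have := nu_sc CW t; have := nu_ge0 CW a; rewrite ger0_norm //; nra.
Qed.

Lemma nu_scr t : 0 <= t -> nu (sc t) <= t.
Proof. by move=> t0; have := nu_sc CW t; rewrite ger0_norm. Qed.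

Lemma sc2 : sc 2 = 1 + 1.
Proof. by rewrite rmorph_nat mulr2n. Qed.

Lemma scK t a : t != 0 -> sc t * (sc t^-1 * a) = a.
Proof. by move=> t0; rewrite mulrA -rmorphM mulfV // rmorph1 mul1r. Qed.

Lemma scVK t a : t != 0 -> sc t^-1 * (sc t * a) = a.
Proof. by move=> t0; rewrite mulrA -rmorphM mulVf // rmorph1 mul1r. Qed.

Lemma nu_close a b : nu a <= nu b + nu (a - b).
Proof. by rewrite -{1}(subrK b a) addrC (nuD CW). Qed.

(** * Self-adjoint and positive elements, approximate square roots *)

Definition sa a := star a = a.

Lemma saD a b : sa a -> sa b -> sa (a + b).
Proof. by rewrite /sa (wstarD CW) => -> ->. Qed.

Lemma saN a : sa a -> sa (- a).
Proof. by rewrite /sa wstarN => ->. Qed.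

Lemma saB a b : sa a -> sa b -> sa (a - b).
Proof. by move=> ha hb; apply/saD/saN. Qed.

Lemma sa_sc t : sa (sc t).
Proof. exact: (wstar_sc CW). Qed.

Lemma sa1 : sa 1.
Proof. exact: wstar1. Qed.

Lemma saM a b : sa a -> sa b -> a * b = b * a -> sa (a * b).
Proof. by rewrite /sa (wstarM CW) => -> ->. Qed.

Lemma saX a n : sa a -> sa (a ^+ n).
Proof.
move=> ha; elim: n => [|n ih]; first exact: sa1.
by rewrite exprS; apply: saM => //; exact: commrX.
Qed.

Lemma nu_sa a : sa a -> nu a ^+ 2 <= nu (a * a).
Proof. by move=> ha; have := nuC CW a; rewrite ha. Qed.

(** The norm characterisation of positivity: in a C*-algebra it places the spectrum in [[0, 2 t]],
    but it makes sense without a spectrum. *)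
Definition Pos a := sa a /\ exists2 t : R, 0 <= t & nu (sc t - a) <= t.

Lemma Pos_ge a : Pos a -> exists2 t0 : R, 0 <= t0 &
  forall t, t0 <= t -> nu (sc t - a) <= t.
Proof.
move=> [_ [t0 t00 h]]; exists t0 => // t tt.
have -> : sc t - a = sc (t - t0) + (sc t0 - a).
  by rewrite rmorphB /=; ncring.
apply: (le_trans (nuD CW _ _)).
by have := @nu_scr (t - t0); lra.
Qed.

Lemma PosD a b : Pos a -> Pos b -> Pos (a + b).
Proof.
move=> [sa_a [t t0 ht]] [sa_b [s s0 hs]]; split; first exact: saD.
exists (t + s); first lra.
have -> : sc (t + s) - (a + b) = (sc t - a) + (sc s - b).
  by rewrite rmorphD /=; ncring.
by apply: (le_trans (nuD CW _ _)); lra.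
Qed.

Lemma PosZ t a : 0 <= t -> Pos a -> Pos (sc t * a).
Proof.
move=> t0 [sa_a [s s0 hs]]; split.
  by apply: saM => //; [exact: sa_sc|exact: (sc_comm CW)].
exists (t * s); first exact: mulr_ge0.
rewrite rmorphM -mulrBr; apply: (le_trans (nuZ _ t0)); nra.
Qed.

Lemma Pos_shift d a : sa a -> nu a <= d -> Pos (a + sc d).
Proof.
move=> sa_a had; split; first exact/saD/sa_sc.
exists d; first exact: le_trans (nu_ge0 CW _) had.
have -> : sc d - (a + sc d) = - a by ncring.
by rewrite nuN.
Qed.

Lemma Pos_scB d a : sa a -> nu a <= d -> Pos (sc d - a).
Proof.
move=> sa_a had; rewrite addrC; apply: Pos_shift; first exact: saN.
by rewrite nuN.
Qed.

(* The majorants of the Newton iterates [y' = (x + y ^ 2) / 2] for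
   [1 - sqrt (1 - x)] when [nu x <= 1]. *)
Fixpoint newton_bound k : R :=
  if k is k'.+1 then (1 + newton_bound k' ^+ 2) / 2 else 0.

Fixpoint newton (x : W) k : W :=
  if k is k'.+1 then sc 2^-1 * (x + newton x k' * newton x k') else 0.

Lemma newton_bound_itv k : 0 <= newton_bound k <= 1.
Proof.
elim: k => [|k /andP[h1 h2]] /=; first by lra.
by apply/andP; split; nra.
Qed.

(** Steps all larger than [e] would carry the majorants past their bound [1]. *)
Lemma newton_bound_step e : 0 < e -> exists k,
  newton_bound k.+1 - newton_bound k <= e.
Proof.
move=> e0; apply: contrapT => /forallNP h.
have hk k : k%:R * e <= newton_bound k.
  elim: k => [|k ih]; first by rewrite mul0r.
  have /negP := h k; rewrite -ltNge => hk.
  rewrite -natr1 mulrDl mul1r; lra.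
have [n hn] : exists n, e^-1 < n%:R.
  exists (Num.bound e^-1); apply: archi_boundP; rewrite invr_ge0; exact: ltW.
have := hk n; have /andP[_] := newton_bound_itv n.
move: hn; rewrite -(ltr_pM2r e0) mulVf ?gt_eqF //; lra.
Qed.

Lemma sa_newton x k : sa x -> sa (newton x k).
Proof.
move=> hx; elim: k => [|k ih] /=; first exact: wstar0.
apply: saM; [exact: sa_sc| |exact: (sc_comm CW)].
by apply: saD => //; apply: saM.
Qed.

Lemma comm_newton x b k : x * b = b * x -> newton x k * b = b * newton x k.
Proof.
move=> hx; elim: k => [|k ih] /=; first by rewrite mul0r mulr0.
rewrite -mulrA mulrDl hx -mulrA ih mulrA ih -mulrA -mulrDr.
by rewrite mulrA (sc_comm CW) -mulrA.
Qed.

Lemma nu0 : nu 0 <= 0.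
Proof. by have := nu_sc CW 0; rewrite rmorph0 normr0. Qed.

Lemma nu_newton x k : nu x <= 1 -> nu (newton x k) <= newton_bound k.
Proof.
move=> hx; elim: k => [|k ih] /=; first exact: nu0.
have h2 : (0 : R) <= 2^-1 by rewrite invr_ge0.
apply: (le_trans (nuZ _ h2)); rewrite mulrC ler_pM2r ?invr_gt0 //.
apply: (le_trans (nuD CW _ _)); apply: lerD => //.
apply: (le_trans (nuM CW _ _)); have := nu_ge0 CW (newton x k); nra.
Qed.

(** The iterates commute, so the difference of two squares factors as [(y1 - y0) * (y1 + y0)]; the
    scalar majorants obey the same factored recursion. *)
Lemma nu_newton_step x k : nu x <= 1 ->
  nu (newton x k.+1 - newton x k) <= newton_bound k.+1 - newton_bound k.
Proof.
move=> hx; elim: k => [|k ih].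
  rewrite !subr0 /= mulr0 expr0n /= !addr0.
  have h2 : (0 : R) <= 2^-1 by rewrite invr_ge0.
  by apply: (le_trans (nuZ _ h2)); rewrite mulrC ler_pM2r ?invr_gt0.
have h2 : (0 : R) <= 2^-1 by rewrite invr_ge0.
set y1 := newton x k.+1; set y0 := newton x k.
have c01 : y1 * y0 = y0 * y1.
  by apply: comm_newton; symmetry; apply: comm_newton.
have -> : newton x k.+2 - y1 = sc 2^-1 * ((y1 - y0) * (y1 + y0)).
  have E1 : y1 = sc 2^-1 * (x + y0 * y0) by [].
  transitivity (sc 2^-1 * (x + y1 * y1) - sc 2^-1 * (x + y0 * y0)).
    by rewrite -E1.
  have -> : (y1 - y0) * (y1 + y0) = y1 * y1 - y0 * y0 + (y1 * y0 - y0 * y1).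
    by ncring.
  by rewrite c01 subrr addr0; ncring.
apply: (le_trans (nuZ _ h2)).
have hM := nuM CW (y1 - y0) (y1 + y0); have hD := nuD CW y1 y0.
have := nu_newton k.+1 hx; have := nu_newton k hx; rewrite -/y1 -/y0.
have /andP[] := newton_bound_itv k; have /andP[] := newton_bound_itv k.+1.
move: ih; rewrite -/y1 -/y0.
have -> : newton_bound k.+2 = (1 + newton_bound k.+1 ^+ 2) / 2 by [].
have : newton_bound k.+1 = (1 + newton_bound k ^+ 2) / 2 by [].
have := nu_ge0 CW (y1 + y0); have := nu_ge0 CW (y1 - y0).
have := nu_ge0 CW y1; have := nu_ge0 CW y0.
move: hM hD; move: (nu ((y1 - y0) * _)) (nu (y1 - y0)) (nu (y1 + y0)).
move: (nu y1) (nu y0) (newton_bound k.+1) (newton_bound k) => D E r1 r0 A B C *.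
have : B * C <= (r1 - r0) * (r1 + r0) by apply: ler_pM; lra.
nra.
Qed.

(** For an iterate [y] at [1 - g], the defect of [1 - y] as a square root of [g] is twice the next
    iteration step. The commutation clause replaces functional calculus: approximate roots of
    commuting elements commute. *)
Lemma approx_sqrt1 g e : sa g -> nu (1 - g) <= 1 -> 0 < e ->
  exists v, [/\ Pos v, nu (v * v - g) <= e &
    forall b, g * b = b * g -> v * b = b * v].
Proof.
move=> hg hg1 e0; have e20 : 0 < e / 2 by lra.
have [k hk] := newton_bound_step e20.
set y := newton (1 - g) k; exists (1 - y).
have sa_y : sa y by apply: sa_newton; apply: saB => //; exact: sa1.
split.
- split; first by apply: saB => //; exact: sa1.
  exists 1 => //; rewrite rmorph1.
  have -> : 1 - (1 - y) = y by ncring.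
  by have /andP[_] := newton_bound_itv k; have := nu_newton k hg1; exact: le_trans.
- have -> : (1 - y) * (1 - y) - g = sc 2 * (newton (1 - g) k.+1 - y).
    have -> : newton (1 - g) k.+1 = sc 2^-1 * (1 - g + y * y) by [].
    rewrite [RHS]mulrBr scK ?pnatr_eq0 // sc2.
    by ncring.
  apply: (le_trans (nuZ _ _)) => //.
  by have := nu_newton_step k hg1; rewrite -/y; lra.
move=> b hb; have -> : (1 - y) * b = b - y * b by ncring.
rewrite comm_newton; first by ncring.
by rewrite mulrBl mulrBr mul1r mulr1 hb.
Qed.

(** Dividing by a large [t] brings [g] within distance [1] of the unit; the root is then scaled back
    by [sqrt t]. *)
Lemma approx_sqrt g e : Pos g -> 0 < e ->
  exists v, [/\ Pos v, nu (v * v - g) <= e &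
    forall b, g * b = b * g -> v * b = b * v].
Proof.
move=> Pg e0; have [t0 t00 ht] := Pos_ge Pg.
pose t := t0 + 1; have tp : 0 < t by rewrite /t; lra.
have hgt : nu (sc t - g) <= t by apply: ht; rewrite /t; lra.
have tne : t != 0 by rewrite gt_eqF.
have t'0 : 0 <= t^-1 by rewrite invr_ge0; exact: ltW.
have [|||v [Pv hv cv]] := @approx_sqrt1 (sc t^-1 * g) (e / t); last first.
- pose r := Num.sqrt t; have rr : r * r = t by rewrite -expr2 sqr_sqrtr // ltW.
  have r0 : 0 <= r by exact: sqrtr_ge0.
  exists (sc r * v); split; first exact: PosZ.
    have -> : sc r * v * (sc r * v) - g = sc t * (v * v - sc t^-1 * g).
      rewrite mulrBr scK //.
      by rewrite -rr rmorphM -!mulrA [v * (_ * _)]mulrA -(sc_comm CW) -!mulrA.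
    apply: (le_trans (nuZ _ (ltW tp))); rewrite mulrC.
    by rewrite -ler_pdivlMr.
  move=> b hb; rewrite -mulrA cv; first by rewrite mulrA (sc_comm CW) -mulrA.
  by rewrite -mulrA hb !mulrA (sc_comm CW).
- exact: divr_gt0.
- have -> : 1 - sc t^-1 * g = sc t^-1 * (sc t - g).
    by rewrite mulrBr -rmorphM mulVf // rmorph1.
  apply: (le_trans (nuZ _ t'0)); have : t^-1 * t = 1 by rewrite mulVf.
  by nra.
- by case: Pg => h _; apply: saM; [exact: sa_sc| |exact: (sc_comm CW)].
Qed.

(* [v + im * w] is normal with square modulus [v ^ 2 + w ^ 2], and [v] is its
   real part. *)
Lemma nu_re v w c : sa v -> sa w -> v * w = w * v ->
  nu (v * v + w * w) <= c -> nu v ^+ 2 <= c.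
Proof.
move=> hv hw cvw hc; pose u := v + im * w.
have su : star u = v - im * w.
  by rewrite (wstarD CW) (wstarM CW) hv hw (wstar_im CW) mulrN -(im_comm CW).
have hu : nu u ^+ 2 <= c.
  apply: (le_trans (nuC CW _)); rewrite su.
  suff -> : (v - im * w) * u = v * v + w * w by [].
  have -> : (v - im * w) * u = v * v + (v * im) * w - im * (w * v)
    - im * (w * im) * w by rewrite /u; ncring.
  rewrite -[v * im](im_comm CW) -[w * im](im_comm CW).
  by rewrite [im * (im * w)]mulrA (im_sqr CW) -[im * v * w]mulrA cvw; ncring.
have hvu : nu v <= nu u.
  have -> : v = sc 2^-1 * (u + star u).
    have -> : u + star u = sc 2 * v by rewrite su /u sc2; ncring.
    by rewrite scVK ?pnatr_eq0.
  have h2 : (0 : R) <= 2^-1 by rewrite invr_ge0.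
  apply: (le_trans (nuZ _ h2)); rewrite mulrC ler_pdivrMr //.
  by apply: (le_trans (nuD CW _ _)); rewrite nu_star; lra.
by apply: le_trans hu; have := nu_ge0 CW v; nra.
Qed.

(** Approximate roots [v] of [b] and [w] of [c - b] commute, and [v * v + w * w] is close to [c];
    [nu_re] then bounds [v], hence [b]. *)
Lemma Pos_nu_le b c : 0 <= c -> Pos b -> Pos (sc c - b) -> nu b <= c.
Proof.
move=> c0 Pb Pcb; apply: le_eps => e' e'0.
have e0 : 0 < e' / 3 by lra.
have [v [Pv hv cv]] := approx_sqrt Pb e0.
have [w [Pw hw cw]] := approx_sqrt Pcb e0.
have hc : v * w = w * v.
  symmetry; apply: cw; symmetry.
  rewrite mulrBr mulrBl (sc_comm CW); congr (_ - _).
  by apply: cv.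
have h : nu (v * v + w * w) <= c + e' / 3 + e' / 3.
  have -> : v * v + w * w = sc c + (v * v - b) + (w * w - (sc c - b)).
    by ncring.
  apply: (le_trans (nuD CW _ _)); apply: lerD => //.
  apply: (le_trans (nuD CW _ _)); apply: lerD => //.
  exact: nu_scr.
have := nu_re Pv.1 Pw.1 hc h.
have := nu_close b (v * v); rewrite nuBC; have := nuM CW v v.
by rewrite expr2; lra.
Qed.

(** Any bound of the norm may serve as the witness in [Pos]: [Pos_nu_le] is applied to [t - a],
    whose complement to [t] is [a]. *)
Lemma Pos_bound a t : Pos a -> nu a <= t -> nu (sc t - a) <= t.
Proof.
move=> Pa hat; apply: Pos_nu_le; first exact: le_trans (nu_ge0 CW _) hat.
  exact: Pos_scB Pa.1 hat.
by have -> : sc t - (sc t - a) = a by ncring.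
Qed.

(** The witness [nu a + 1] bounds the norms of all [a + d] with [d <= 1] at once, so the estimate
    passes to the limit. *)
Lemma Pos_lim a : sa a -> (forall d, 0 < d -> Pos (a + sc d)) -> Pos a.
Proof.
move=> sa_a h; split => //; exists (nu a + 1).
  by have := nu_ge0 CW a; lra.
apply: le_eps => e e0; pose d := Num.min 1 (e / 2).
have d0 : 0 < d by rewrite lt_min; apply/andP; split; lra.
have d1 : d <= 1 by rewrite ge_min lexx.
have de : d <= e / 2 by rewrite ge_min lexx orbT.
have := Pos_bound (h d d0); move/(_ (nu a + 1)).
have := nuD CW a (sc d); have := nu_scr (ltW d0) => h1 h2.
move=> /(_ ltac:(lra)) h3.
have -> : sc (nu a + 1) - a = sc (nu a + 1) - (a + sc d) + sc d by ncring.
by apply: (le_trans (nuD CW _ _)); lra.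
Qed.

(** The witness is [s ^+ 2] with [s = nu h]: an approximate root [w] of [s ^+ 2 - h * h] commutes
    with [h], and [nu_re] bounds [w * w] by about [s ^+ 2]. *)
Lemma Pos_sqr h : sa h -> Pos (h * h).
Proof.
move=> sh; have shh : sa (h * h) by exact: saM.
pose s := nu h; have s0 : 0 <= s by exact: (nu_ge0 CW).
split => //; exists (s ^+ 2); first by rewrite exprn_ge0.
apply: le_eps => e' e'0; have e0 : 0 < e' / 2 by lra.
have Pg : Pos (sc (s ^+ 2) - h * h).
  by apply: Pos_scB => //; rewrite expr2; exact: (nuM CW).
have [w [Pw hw cw]] := approx_sqrt Pg e0.
have cwh : w * h = h * w by apply: cw; rewrite mulrBl mulrBr (sc_comm CW) mulrA.
have hs : nu (w * w + h * h) <= s ^+ 2 + e' / 2.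
  have -> : w * w + h * h = sc (s ^+ 2) + (w * w - (sc (s ^+ 2) - h * h)).
    by ncring.
  apply: (le_trans (nuD CW _ _)); apply: lerD => //; apply: nu_scr.
  exact: exprn_ge0.
have := nu_re Pw.1 sh cwh hs; have := nuM CW w w.
have := nu_close (sc (s ^+ 2) - h * h) (w * w).
by rewrite [nu (_ - w * w)]nuBC expr2; lra.
Qed.

Lemma Pos_near a b d : sa a -> Pos b -> nu (a - b) <= d -> Pos (a + sc d).
Proof.
move=> ha Pb hd; have -> : a + sc d = b + (a - b + sc d) by ncring.
by apply: PosD => //; apply: Pos_shift => //; exact: saB ha Pb.1.
Qed.

(** Commuting approximate roots [v], [w] make [a * b] close to the square of the self-adjoint
    element [v * w]. *)
Lemma PosM a b : Pos a -> Pos b -> a * b = b * a -> Pos (a * b).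
Proof.
move=> Pa Pb cab; have sab : sa (a * b) by apply: saM => //; [exact: Pa.1|exact: Pb.1].
apply: Pos_lim => // d d0.
pose M := nu a + nu b + 1; pose e := Num.min 1 (d / M).
have na := nu_ge0 CW a; have nb := nu_ge0 CW b.
have M0 : 0 < M by rewrite /M; lra.
have e0 : 0 < e by rewrite lt_min ltr01 divr_gt0.
have e1 : e <= 1 by rewrite ge_min lexx.
have eM : e * M <= d by rewrite -ler_pdivlMr // ge_min lexx orbT.
have [v [Pv hv cv]] := approx_sqrt Pa e0.
have [w [Pw hw cw]] := approx_sqrt Pb e0.
have cvw : v * w = w * v by symmetry; apply: cw; symmetry; exact: cv.
apply: (@Pos_near _ ((v * w) * (v * w))) => //.
  by apply: Pos_sqr; apply: saM => //; [exact: Pv.1|exact: Pw.1].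
have -> : a * b - v * w * (v * w) = - ((v * v - a) * b) - v * v * (w * w - b).
  have -> : v * w * (v * w) = v * (w * v) * w by rewrite !mulrA.
  by rewrite -cvw; ncring.
apply: (le_trans (nuB _ _)); rewrite nuN.
have := nuM CW (v * v - a) b; have := nuM CW (v * v) (w * w - b).
have := nu_close (v * v) a; move: eM; rewrite /M => eM.
move: hv hw; have := nu_ge0 CW (v * v); have := nu_ge0 CW (v * v - a).
have := nu_ge0 CW (w * w - b).
move: (nu (v * v)) (nu (v * v - a)) (nu (w * w - b)) => A B C *.
have : B * nu b <= e * nu b by apply: ler_wpM2r.
have : A * C <= (nu a + 1) * e by apply: ler_pM => //; lra.
nra.
Qed.

Lemma PosX a n : Pos a -> Pos (a ^+ n).
Proof.
move=> Pa; elim: n => [|n ih].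
  split; first exact: sa1.
  by exists 1 => //; rewrite rmorph1 expr0 subrr; have := nu0; lra.
by rewrite exprS; apply: PosM => //; exact: commrX.
Qed.

Lemma nu_X2 b k : sa b -> nu b ^+ (2 ^ k)%N <= nu (b ^+ (2 ^ k)%N).
Proof.
move=> hb; elim: k => [|k ih]; first by rewrite !expr1.
have sX := saX (2 ^ k)%N hb.
rewrite expnSr !exprM [(b ^+ _) ^+ 2]expr2; apply: le_trans (nu_sa sX).
by rewrite ler_pXn2r // ?nnegrE ?exprn_ge0 // (nu_ge0 CW).
Qed.


(* The identity [z (s - z* z) ^ k = (s - z z* ) ^ k z] makes the powers of
   [s - z* z] grow at most linearly, which bounds its norm since it is
   self-adjoint. *)
Lemma nu_starM_small z d : 0 <= d -> Pos (z * star z + sc d) ->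
  Pos (sc d - star z * z) -> nu (star z * z) <= 3 * d.
Proof.
move=> d0 PP PN; pose s := nu z ^+ 2; pose a := star z * z.
have s0 : 0 <= s by exact: sqr_ge0.
have sa_a : sa a by rewrite /sa /a (wstarM CW) (wstarK CW).
pose q := sc s - z * star z; pose r := s + d.
have hr0 : 0 <= r by rewrite /r; lra.
have hq : nu q <= r.
  have -> : q = sc r - (z * star z + sc d) by rewrite /q /r rmorphD /=; ncring.
  apply: Pos_bound => //; apply: (le_trans (nuD CW _ _)).
  rewrite /r; apply: lerD; last exact: nu_scr.
  by apply: (le_trans (nuM CW _ _)); rewrite nu_star -expr2.
pose B := sc s - a.
have sB : sa B by apply: saB => //; exact: sa_sc.
have zB k : z * B ^+ k = q ^+ k * z.
  elim: k => [|k ih]; first by rewrite mulr1 mul1r.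
  have zB1 : z * B = q * z by rewrite /B /q /a mulrBr mulrBl (sc_comm CW) !mulrA.
  by rewrite !exprS mulrA zB1 -mulrA ih mulrA.
have hqX k : nu (q ^+ k) <= r ^+ k.
  elim: k => [|k ih]; first exact: nu1.
  rewrite !exprS; apply: (le_trans (nuM CW _ _)).
  by apply: ler_pM => //; exact: (nu_ge0 CW).
have haB k : nu (a * B ^+ k) <= s * r ^+ k.
  rewrite /a -mulrA zB; apply: (le_trans (nuM CW _ _)); rewrite nu_star.
  rewrite /s expr2 -mulrA; apply: ler_wpM2l; first exact: (nu_ge0 CW).
  apply: (le_trans (nuM CW _ _)); rewrite mulrC.
  by apply: ler_wpM2l => //; exact: (nu_ge0 CW).
have hB k : nu (B ^+ k) <= (1 + k%:R) * r ^+ k.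
  elim: k => [|k ih]; first by rewrite addr0 mulr1; exact: nu1.
  have -> : B ^+ k.+1 = sc s * B ^+ k - a * B ^+ k by rewrite exprS mulrBl.
  apply: (le_trans (nuB _ _)); have := nuZ (B ^+ k) s0; have := haB k.
  have : 0 <= r ^+ k by exact: exprn_ge0.
  rewrite exprS -natr1; have : 0 <= k%:R :> R by [].
  have : s <= r by rewrite /r; lra.
  have := nu_ge0 CW (B ^+ k).
  move: (nu (sc s * _)) (nu (a * _)) => C D; move: ih.
  move: (nu (B ^+ k)) (r ^+ k) (k%:R : R) => A y m *.
  have : s * A <= r * ((1 + m) * y).
    by apply: ler_pM.
  have : s * y <= r * y by apply: ler_wpM2r.
  nra.
have nuB : nu B <= r.
  by apply: ler_of_pow2 => // k; apply: (le_trans (nu_X2 k sB)).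
(* [nu B <= r] says that [a + d] is positive with witness [r]; the hypothesis on [d - star z * z]
   caps it by [2 * d]. *)
have h2 : nu (a + sc d) <= 2 * d.
  apply: Pos_nu_le; first lra.
    split; first exact/saD/sa_sc.
    exists r => //; suff -> : sc r - (a + sc d) = B by [].
    by rewrite /r /B rmorphD /=; ncring.
  have -> : sc (2 * d) - (a + sc d) = sc d - a; last by [].
  by rewrite rmorphM sc2 /=; ncring.
have := nu_close a (a + sc d); have -> : a - (a + sc d) = - sc d by ncring.
by rewrite nuN; have := nu_scr d0; rewrite -/a; lra.
Qed.

(* With [k] close to [|h|] and [m = k - h], the element [z = x m] satisfies
   [z* z = m h m], which is close to [- k m ^ 2 <= 0]. *)
Lemma Pos_starM x : Pos (star x * x).
Proof.
pose h := star x * x; rewrite -/h.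
have sh : sa h by rewrite /sa /h (wstarM CW) (wstarK CW).
apply: Pos_lim => // eta eta0.
have nh := nu_ge0 CW h; pose M := 2 * nu h + 1; pose c := 4 * (nu h + 1) * M.
have M1 : 1 <= M by rewrite /M; lra.
have cp : 0 < c by rewrite /c; nra.
have eta4 : 0 < eta ^+ 4 / 16 / c.
  by rewrite !divr_gt0 // exprn_gt0.
(* The three caps serve, in turn, the bound on [nu k], the passage from [k * m] to [m], and the
   bound on [k * m]. *)
pose e := Num.min 1 (Num.min (eta ^+ 2 / 2) (eta ^+ 4 / 16 / c)).
have e0 : 0 < e.
  by rewrite !lt_min ltr01 eta4 divr_gt0 // exprn_gt0.
have e1 : e <= 1 by rewrite ge_min lexx.
have e2 : e <= eta ^+ 2 / 2 by rewrite !ge_min lexx orbT.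
have e3 : c * e <= eta ^+ 4 / 16.
  by rewrite mulrC -ler_pdivlMr // !ge_min lexx !orbT.
have [k [Pk hk ck]] := approx_sqrt (Pos_sqr sh) e0.
have ckh : k * h = h * k by apply: ck; rewrite mulrA.
pose m := k - h; pose E := k * k - h * h.
have sm : sa m by exact: saB Pk.1 sh.
have cmk : m * k = k * m by rewrite /m mulrBl mulrBr ckh.
have EE : (k + h) * m = E.
  have -> : (k + h) * m = E + (h * k - k * h) by rewrite /m /E; ncring.
  by rewrite ckh subrr addr0.
have nk : nu k <= nu h + 1.
  apply: ler_of_sqr; first lra.
  have := nu_sa Pk.1; have := nu_close (k * k) (h * h); have := nuM CW h h.
  by move: hk; rewrite -/E; nra.
have nm : nu m <= M by have := nuB k h; rewrite -/m /M; lra.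
have nE : nu E <= e by [].
pose z := x * m; pose d := e * M.
have d0 : 0 <= d by rewrite /d; nra.
have zz : star z * z = m * h * m.
  by rewrite /z /h (wstarM CW) sm !mulrA.
have szz : sa (star z * z) by rewrite /sa (wstarM CW) (wstarK CW).
have kmm : k * (m * m) + m * h * m = E * m.
  have cmh : m * h = h * m by rewrite /m mulrBl mulrBr ckh.
  by rewrite cmh -EE; ncring.
have hEm : nu (E * m) <= d.
  apply: (le_trans (nuM CW _ _)); apply: ler_pM => //; exact: (nu_ge0 CW).
have Pkmm : Pos (k * (m * m)).
  apply: PosM => //; first exact: Pos_sqr.
  by rewrite mulrA -cmk -!mulrA -cmk.
have PN : Pos (sc d - star z * z).
  rewrite addrC; apply: Pos_near Pkmm _; first exact: saN.
  have -> : - (star z * z) - k * (m * m) = - (E * m) by rewrite zz -kmm; ncring.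
  by rewrite nuN.
(* Up to sign, [u] and [v] are twice the real and imaginary parts of [z], so [u * u + v * v] is
   [2 * (z * star z + star z * z)]. This trades the upper bound on [star z * z] for a lower bound on
   [z * star z]. *)
have PP : Pos (z * star z + sc d).
  pose u := z + star z; pose v := im * (z - star z).
  have su : sa u by rewrite /sa /u (wstarD CW) (wstarK CW) addrC.
  have sv : sa v.
    rewrite /sa /v (wstarM CW) wstarB (wstarK CW) (wstar_im CW) (im_comm CW).
    by ncring.
  have -> : z * star z + sc d = sc 2^-1 * (u * u + v * v) + (sc d - star z * z).
    have -> : u * u + v * v = sc 2 * (z * star z + star z * z).
      have -> : v * v = - ((z - star z) * (z - star z)).
        rewrite /v -mulrA [_ * (im * _)]mulrA -(im_comm CW) !mulrA (im_sqr CW).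
        by rewrite -!mulrA mulN1r.
      by rewrite /u sc2; ncring.
    by rewrite scVK ?pnatr_eq0 //; ncring.
  apply: PosD => //; apply: PosZ; first by rewrite invr_ge0.
  by apply: PosD; exact: Pos_sqr.
have := nu_starM_small d0 PP PN; rewrite zz => hmhm.
have nkmm : nu (k * (m * m)) <= 4 * d.
  have -> : k * (m * m) = E * m - m * h * m by rewrite -kmm; ncring.
  by apply: (le_trans (nuB _ _)); lra.
have skm : sa (k * m) by apply: saM => //; exact: Pk.1.
have nkm : nu (k * m) <= eta ^+ 2 / 4.
  apply: ler_of_sqr; first by rewrite divr_ge0 // sqr_ge0.
  apply: (le_trans (nu_sa skm)).
  have -> : k * m * (k * m) = k * (k * (m * m)).
    by rewrite -!mulrA [m * (k * m)]mulrA cmk -!mulrA.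
  apply: (le_trans (nuM CW _ _)); have := nu_ge0 CW k; have := nu_ge0 CW (k * (m * m)).
  move: e3; rewrite /c => e3 h1 h2.
  have : nu k * nu (k * (m * m)) <= (nu h + 1) * (4 * d) by apply: ler_pM.
  rewrite /d; have -> : (eta ^+ 2 / 4) ^+ 2 = eta ^+ 4 / 16 by field.
  by lra.
(* [m * m] is [2 * (k * m) - E], both terms being small; hence [h = k - m] is close to the positive
   element [k]. *)
have nm2 : nu m <= eta.
  apply: ler_of_sqr; first exact: ltW.
  apply: (le_trans (nu_sa sm)).
  have -> : m * m = sc 2 * (k * m) - E.
    have -> : m * m = sc 2 * (k * m) - E + (k * h - h * k) by rewrite sc2 /E /m; ncring.
    by rewrite ckh subrr addr0.
  by apply: (le_trans (nuB _ _)); have := nuZ (k * m) (ler0n R 2); lra.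
by apply: Pos_near Pk _ => //; rewrite nuBC.
Qed.

(** The model is a number [g] in [[0, 1]]. By induction [1 - D ^+ N - N * (g * D ^+ N)] is positive:
    passing from [n] to [n + 1] adds [(n + 1) * (g * (g * D ^+ n))]. *)
Lemma Pos_decay g N : Pos g -> Pos (1 - g) ->
  N%:R * nu (g * (1 - g) ^+ N) <= 1.
Proof.
move=> Pg Pd; pose D := 1 - g; rewrite -/D.
have cgD : g * D = D * g by rewrite /D; ncring.
have cgX n : g * D ^+ n = D ^+ n * g by exact: commrX.
have PgD n : Pos (g * D ^+ n) by apply: PosM => //; exact: PosX.
have PQ : Pos (1 - D ^+ N - N%:R * (g * D ^+ N)).
  elim: N => [|n ih].
    have -> : 1 - D ^+ 0 - 0%:R * (g * D ^+ 0) = sc 0 * 1.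
      by rewrite expr0 rmorph0 !mul0r subrr subr0.
    by apply: PosZ => //; exact: (PosX 0 Pg).
  have -> : 1 - D ^+ n.+1 - n.+1%:R * (g * D ^+ n.+1) =
      (1 - D ^+ n - n%:R * (g * D ^+ n)) + sc n.+1%:R * (g * (g * D ^+ n)).
    have -> : D ^+ n.+1 = D ^+ n - g * D ^+ n by rewrite exprS /D; ncring.
    by rewrite rmorph_nat -natr1; ncring.
  apply: PosD => //; apply: PosZ => //; apply: PosM => //.
  by rewrite -mulrA -cgX.
have PND : Pos (N%:R * (g * D ^+ N)).
  by rewrite -[N%:R](rmorph_nat sc); apply: PosZ.
have h : nu (N%:R * (g * D ^+ N)) <= 1.
  apply: Pos_nu_le => //; rewrite rmorph1.
  have -> : 1 - N%:R * (g * D ^+ N) = (1 - D ^+ N - N%:R * (g * D ^+ N)) + D ^+ N.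
    by ncring.
  by apply: PosD => //; exact: PosX.
case: N h {PQ PND} => [|N] h; first by rewrite mul0r.
have N0 : (0 : R) < N.+1%:R by [].
rewrite mulrC -ler_pdivlMr // mul1r.
have -> : g * D ^+ N.+1 = sc N.+1%:R^-1 * (sc N.+1%:R * (g * D ^+ N.+1)).
  by rewrite scVK // gt_eqF.
apply: (le_trans (nuZ _ _)); first by rewrite invr_ge0.
by rewrite -[leRHS]mulr1 ler_pM2l ?invr_gt0 // rmorph_nat.
Qed.

End PreCstar.

(** * C*-seminorms on a *-algebra *)

Section Complex.
Variable R : realType.
Implicit Types t s : R.

Lemma conj_realC t : ((t%:C)%C)^* = (t%:C)%C :> R[i].
Proof. by rewrite conj_Creal // complex_real. Qed.

Lemma norm_realC t : `|(t%:C)%C| = ((`|t|)%:C)%C :> R[i].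
Proof. by rewrite normc_def /= expr0n addr0 sqrtr_sqr. Qed.

Lemma realCD t s : ((t + s)%:C)%C = (t%:C)%C + (s%:C)%C :> R[i].
Proof. exact: (rmorphD (real_complex R)). Qed.

Lemma realCM t s : ((t * s)%:C)%C = (t%:C)%C * (s%:C)%C :> R[i].
Proof. exact: (rmorphM (real_complex R)). Qed.

End Complex.

Section Seminorm.
Variables (R : realType) (A : lmodType R[i]) (mul : A -> A -> A) (star : A -> A).
Hypothesis HA : is_star_algebra mul star.
Implicit Types (a b : A) (t : R).

Lemma star_algN a : star (- a) = - star a.
Proof. by rewrite -scaleN1r (starZ HA) rmorphN1 scaleN1r. Qed.

Lemma star_algB a b : star (a - b) = star a - star b.
Proof. by rewrite (starD HA) star_algN. Qed.

Lemma star_algZ t a : star ((t%:C)%C *: a) = (t%:C)%C *: star a.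
Proof. by rewrite (starZ HA) conj_realC. Qed.

Lemma mulNl a b : mul (- a) b = - mul a b.
Proof. by rewrite -scaleN1r (mulZl HA) scaleN1r. Qed.

Lemma mulNr a b : mul a (- b) = - mul a b.
Proof. by rewrite -scaleN1r (mulZr HA) scaleN1r. Qed.

Lemma mulBl a b c : mul (a - b) c = mul a c - mul b c.
Proof. by rewrite (mulDl HA) mulNl. Qed.

Lemma mulBr a b c : mul a (b - c) = mul a b - mul a c.
Proof. by rewrite (mulDr HA) mulNr. Qed.

Variable p : A -> R.
Hypothesis Hp : is_Cstar_seminorm mul star p.

Lemma snZ t a : p ((t%:C)%C *: a) = `|t| * p a.
Proof.
by apply: (@complexI R); rewrite /= (sn_homog Hp) norm_realC realCM.
Qed.

Lemma snN a : p (- a) = p a.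
Proof.
apply: (@complexI R); rewrite /= -scaleN1r (sn_homog Hp).
by rewrite normrN1 mul1r.
Qed.

Lemma sn0 : p 0 = 0.
Proof. by have := snZ 0 0; rewrite normr0 mul0r scaler0. Qed.

Lemma snB a b : p (a - b) <= p a + p b.
Proof. by rewrite -(snN b) (sn_triangle Hp). Qed.

Lemma sn_star a : p (star a) = p a.
Proof.
suff h b : p b <= p (star b).
  by apply/le_anti/andP; split=> //; rewrite -{2}[a](starK HA).
have := sn_Cstar Hp b; have := sn_submul Hp (star b) b.
have := sn_ge0 Hp b; have := sn_ge0 Hp (star b).
by move: (p b) (p (star b)) (p _) => x y z *; nra.
Qed.

End Seminorm.

(** * Adjointable operators *)

(** Common ground of two cases: [A] itself with the form [mul a (star b)], and the Hilbert module
    with its inner product. Only one seminorm is in view, so the form may be degenerate for it. *)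
Record is_cs_form (R : realType) (A : lmodType R[i]) (mul : A -> A -> A)
  (star : A -> A) (p : A -> R) (V : lmodType R[i]) (f : V -> V -> A) : Prop := {
  cs_alg : is_star_algebra mul star;
  cs_sn : is_Cstar_seminorm mul star p;
  csDl : forall x y z, f (x + y) z = f x z + f y z;
  csZl : forall (k : R[i]) x y, f (k *: x) y = k *: f x y;
  cs_star : forall x y, f y x = star (f x y);
  cs_ineq : forall x y, p (f x y) <= pbar f p x * pbar f p y
}.

Section CsForm.
Variables (R : realType) (A : lmodType R[i]) (mul : A -> A -> A) (star : A -> A).
Variables (p : A -> R) (V : lmodType R[i]) (f : V -> V -> A).
Hypothesis Hf : is_cs_form mul star p f.
Implicit Types (x y z : V) (t : R).
Let HA := cs_alg Hf.
Let Hp := cs_sn Hf.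
Local Notation n := (pbar f p).

Lemma csDr x y z : f x (y + z) = f x y + f x z.
Proof. by rewrite !(cs_star Hf _ x) (csDl Hf) (starD HA). Qed.

Lemma csZr (k : R[i]) x y : f x (k *: y) = k^* *: f x y.
Proof. by rewrite !(cs_star Hf _ x) (csZl Hf) (starZ HA). Qed.

Lemma csNl x y : f (- x) y = - f x y.
Proof. by rewrite -scaleN1r (csZl Hf) scaleN1r. Qed.

Lemma csNr x y : f x (- y) = - f x y.
Proof. by rewrite -scaleN1r csZr rmorphN1 scaleN1r. Qed.

Lemma pbar_ge0 x : 0 <= n x.
Proof. exact: sqrtr_ge0. Qed.

Lemma pbar_sqr x : n x ^+ 2 = p (f x x).
Proof. by rewrite sqr_sqrtr // (sn_ge0 Hp). Qed.

Lemma pbarD x y : n (x + y) <= n x + n y.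
Proof.
have nx := pbar_ge0 x; have ny := pbar_ge0 y.
apply: ler_of_sqr; first lra.
rewrite pbar_sqr (csDl Hf) !csDr.
apply: (le_trans (sn_triangle Hp _ _)).
have := sn_triangle Hp (f x x) (f x y); have := sn_triangle Hp (f y x) (f y y).
have := cs_ineq Hf x y; have := cs_ineq Hf y x.
by rewrite -!pbar_sqr; lra.
Qed.

Lemma pbarZ t x : n ((t%:C)%C *: x) = `|t| * n x.
Proof.
rewrite /pbar (csZl Hf) csZr conj_realC scalerA -realCM (snZ Hp).
by rewrite sqrtrM // normrM -expr2 sqrtr_sqr normr_id.
Qed.

Lemma pbarZi x : n ('i *: x) = n x.
Proof.
rewrite /pbar (csZl Hf) csZr conjCi scalerA mulrN -expr2 sqrCi opprK.
by rewrite scale1r.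
Qed.

Lemma pbarN x : n (- x) = n x.
Proof. by rewrite /pbar csNl csNr opprK. Qed.

Lemma pbar0 : n 0 = 0.
Proof. by have := pbarZ 0 0; rewrite normr0 mul0r scaler0. Qed.

Lemma pbarB x y : n (x - y) <= n x + n y.
Proof. by rewrite -(pbarN y) pbarD. Qed.

Lemma pbarBC x y : n (x - y) = n (y - x).
Proof. by rewrite -pbarN opprB. Qed.

Lemma pbar_close x y : n x <= n y + n (x - y).
Proof. by rewrite -{1}(subrK y x) addrC pbarD. Qed.

Lemma adjoint_sym (T T' : V -> V) : is_adjoint f T T' -> is_adjoint f T' T.
Proof. by move=> h x y; rewrite (cs_star Hf) -h -(cs_star Hf). Qed.

Lemma adjoint_bound (T T' : V -> V) c : 0 <= c -> is_adjoint f T T' ->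
  (forall x, n (T x) <= c * n x) -> forall y, n (T' y) <= c * n y.
Proof.
move=> c0 adjT hT y; have := adjoint_sym adjT y (T' y) => h.
have : n (T' y) ^+ 2 <= (c * n y) * n (T' y).
  rewrite pbar_sqr h; apply: (le_trans (cs_ineq Hf _ _)).
  by have := hT (T' y); have := pbar_ge0 y; nra.
have := pbar_ge0 (T' y); have : 0 <= c * n y by rewrite mulr_ge0 // pbar_ge0.
by nra.
Qed.

Definition bounded (T : V -> V) := exists2 c : R, 0 <= c & forall x, n (T x) <= c * n x.

Lemma adjoint_bounded (T T' : V -> V) : is_adjoint f T T' ->
  bounded T -> bounded T'.
Proof. by move=> h [c c0 hc]; exists c => //; exact: adjoint_bound h hc. Qed.

(* The form may be degenerate, so an operator does not determine its adjoint. *)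
Record ops_of (Hg : is_cs_form mul star p f) := Ops {
  op : V -> V;
  opadj : V -> V;
  op_linear : linear op;
  opadj_linear : linear opadj;
  op_adjoint : is_adjoint f op opadj;
  op_bounded : bounded op
}.
End CsForm.

HB.instance Definition _ (R : realType) A mul star p V f Hf :=
  gen_eqMixin (@ops_of R A mul star p V f Hf).
HB.instance Definition _ (R : realType) A mul star p V f Hf :=
  gen_choiceMixin (@ops_of R A mul star p V f Hf).

Section Operators.
Variables (R : realType) (A : lmodType R[i]) (mul : A -> A -> A) (star : A -> A).
Variables (p : A -> R) (V : lmodType R[i]) (f : V -> V -> A).
Variable Hf : is_cs_form mul star p f.
Local Notation n := (pbar f p).
Local Notation W := (ops_of Hf).
Implicit Types (S T : W) (x y : V).

Lemma ops_eq S T : op S =1 op T -> opadj S =1 opadj T -> S = T.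
Proof.
case: S => a b h1 h2 h3 h4; case: T => a' b' h1' h2' h3' h4' /= /funext e1 /funext e2.
move: h1 h2 h3 h4; rewrite e1 e2 => h1 h2 h3 h4.
by congr Ops; exact: Prop_irrelevance.
Qed.

Lemma opD T x y : op T (x + y) = op T x + op T y.
Proof. by have := op_linear T 1 x y; rewrite !scale1r. Qed.

Lemma opadjD T x y : opadj T (x + y) = opadj T x + opadj T y.
Proof. by have := opadj_linear T 1 x y; rewrite !scale1r. Qed.

Lemma opZ T k x : op T (k *: x) = k *: op T x.
Proof.
have h0 : op T 0 = 0 by apply: (addrI (op T 0)); rewrite -opD !addr0.
by have := op_linear T k x 0; rewrite !addr0 h0 addr0.
Qed.

Lemma opadjZ T k x : opadj T (k *: x) = k *: opadj T x.
Proof.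
have h0 : opadj T 0 = 0 by apply: (addrI (opadj T 0)); rewrite -opadjD !addr0.
by have := opadj_linear T k x 0; rewrite !addr0 h0 addr0.
Qed.

Definition op_add S T : W.
Proof.
refine (@Ops _ _ _ _ _ _ _ Hf (fun x => op S x + op T x)
  (fun x => opadj S x + opadj T x) _ _ _ _).
- by move=> k x y; rewrite !op_linear scalerDr addrACA.
- by move=> k x y; rewrite !opadj_linear scalerDr addrACA.
- by move=> x y; rewrite (csDl Hf) (csDr Hf) !op_adjoint.
- have [c c0 hc] := op_bounded S; have [d d0 hd] := op_bounded T.
  exists (c + d) => [|x]; first exact: addr_ge0.
  by apply: (le_trans (pbarD Hf _ _)); rewrite mulrDl lerD.
Defined.

(** The factor [c] is a parameter so that real scalars and ['i] share one construction. *)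
Definition op_scale (k : R[i]) (c : R) (hk : forall x, n (k *: x) = c * n x)
  (c0 : 0 <= c) : W.
Proof.
refine (@Ops _ _ _ _ _ _ _ Hf (fun x => k *: x)
  (fun x => k^* *: x) _ _ _ _).
- by move=> l x y; rewrite scalerDr !scalerA mulrC.
- by move=> l x y; rewrite scalerDr !scalerA mulrC.
- by move=> x y; rewrite (csZl Hf) (csZr Hf) conjCK.
- by exists c => // x; rewrite hk.
Defined.

Definition op_mul S T : W.
Proof.
refine (@Ops _ _ _ _ _ _ _ Hf (fun x => op S (op T x))
  (fun x => opadj T (opadj S x)) _ _ _ _).
- by move=> k x y; rewrite !op_linear.
- by move=> k x y; rewrite !opadj_linear.
- by move=> x y; rewrite !op_adjoint.
- have [c c0 hc] := op_bounded S; have [d d0 hd] := op_bounded T.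
  exists (c * d) => [|x]; first exact: mulr_ge0.
  by apply: (le_trans (hc _)); rewrite -mulrA ler_wpM2l.
Defined.

Definition op_star T : W.
Proof.
refine (@Ops _ _ _ _ _ _ _ Hf (opadj T) (op T) (opadj_linear T) (op_linear T)
  _ _).
- exact: (adjoint_sym Hf (op_adjoint T)).
- exact: (adjoint_bounded Hf (op_adjoint T) (op_bounded T)).
Defined.

Definition op_real (t : R) : W := op_scale (pbarZ Hf t) (normr_ge0 t).

Definition op_im : W :=
  op_scale (fun x => etrans (pbarZi Hf x) (esym (mul1r _))) ler01.

Lemma op_realE t x : op (op_real t) x = (t%:C)%C *: x. Proof. by []. Qed.

Lemma opadj_realE t x : opadj (op_real t) x = (t%:C)%C *: x.
Proof. by rewrite /= conj_realC. Qed.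

Definition op_opp T : W := op_mul (op_real (- 1)) T.

Lemma realCN1 : ((-1)%:C)%C = -1 :> R[i].
Proof. by rewrite (rmorphN1 (real_complex R)). Qed.

Lemma op_addA : associative op_add.
Proof. by move=> S T U; apply: ops_eq => x /=; rewrite addrA. Qed.

Lemma op_addC : commutative op_add.
Proof. by move=> S T; apply: ops_eq => x /=; rewrite addrC. Qed.

Lemma op_add0 : left_id (op_real 0) op_add.
Proof.
by move=> T; apply: ops_eq => x; rewrite [LHS]/= ?conj_realC scale0r add0r.
Qed.

Lemma op_addN : left_inverse (op_real 0) op_opp op_add.
Proof.
move=> T; apply: ops_eq => x; rewrite [LHS]/= ?opadjZ ?conj_realC realCN1.
  by rewrite scaleN1r addNr /= scale0r.
by rewrite scaleN1r addNr /= conj_realC scale0r.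
Qed.

HB.instance Definition _ :=
  GRing.isZmodule.Build W op_addA op_addC op_add0 op_addN.

Lemma op_mulA : associative op_mul.
Proof. by move=> S T U; apply: ops_eq. Qed.

Lemma op_mul1 : left_id (op_real 1) op_mul.
Proof. by move=> T; apply: ops_eq => x; rewrite [LHS]/= ?conj_realC scale1r. Qed.

Lemma op_mulr1 : right_id (op_real 1) op_mul.
Proof. by move=> T; apply: ops_eq => x; rewrite [LHS]/= ?conj_realC scale1r. Qed.

Lemma op_mulDl : left_distributive op_mul op_add.
Proof. by move=> S T U; apply: ops_eq => x //=; rewrite opadjD. Qed.

Lemma op_mulDr : right_distributive op_mul op_add.
Proof. by move=> S T U; apply: ops_eq => x //=; rewrite opD. Qed.

HB.instance Definition _ := GRing.Zmodule_isPzRing.Build W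
  op_mulA op_mul1 op_mulr1 op_mulDl op_mulDr.

Lemma opE_add S T x : op (S + T) x = op S x + op T x. Proof. by []. Qed.

Lemma opE_mul S T x : op (S * T) x = op S (op T x). Proof. by []. Qed.

Lemma opE_1 x : op (1 : W) x = x. Proof. exact: scale1r. Qed.

Lemma opE_opp T x : op (- T) x = - op T x.
Proof. by rewrite [LHS]/= realCN1 scaleN1r. Qed.

Lemma opadjE_opp T x : opadj (- T) x = - opadj T x.
Proof. by rewrite [LHS]/= conj_realC realCN1 scaleN1r -scaleN1r opadjZ scaleN1r. Qed.

Lemma op_real_zmod_morphism : zmod_morphism op_real.
Proof.
move=> s t; apply: ops_eq => x.
  by rewrite opE_add opE_opp !op_realE -scalerBl -(rmorphB (real_complex R)).
have -> : opadj (op_real s - op_real t) x =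
  opadj (op_real s) x + opadj (- op_real t) x by [].
by rewrite opadjE_opp !opadj_realE -scalerBl -(rmorphB (real_complex R)).
Qed.

Lemma op_real_monoid_morphism : monoid_morphism op_real.
Proof.
split=> // s t; apply: ops_eq => x.
  by rewrite opE_mul !op_realE scalerA realCM.
have -> : opadj (op_real s * op_real t) x =
  opadj (op_real t) (opadj (op_real s) x) by [].
by rewrite !opadj_realE scalerA realCM mulrC.
Qed.

HB.instance Definition _ :=
  GRing.isZmodMorphism.Build R W op_real op_real_zmod_morphism.
HB.instance Definition _ :=
  GRing.isMonoidMorphism.Build R W op_real op_real_monoid_morphism.

Definition opnorm T : R :=
  inf [set c | 0 <= c /\ forall x, n (op T x) <= c * n x].

Lemma opnorm_ge0 T : 0 <= opnorm T.
Proof.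
apply: lb_le_inf; last by move=> c [].
by have [c c0 hc] := op_bounded T; exists c.
Qed.

Lemma opnormP T x : n (op T x) <= opnorm T * n x.
Proof.
have [c c0 hc] := op_bounded T.
have := pbar_ge0 p f x; rewrite le_eqVlt => /predU1P[x0|xp].
  by rewrite -x0 mulr0; have := hc x; rewrite -x0 mulr0.
rewrite -ler_pdivrMr //; apply: lb_le_inf; first by exists c.
by move=> d [d0 hd]; rewrite ler_pdivrMr.
Qed.

Lemma opnorm_le T c : 0 <= c -> (forall x, n (op T x) <= c * n x) ->
  opnorm T <= c.
Proof. by move=> c0 hc; apply: ge_inf => //; exists 0 => d []. Qed.

Lemma ops_pre_cstar :
  is_pre_cstar (op_real : {rmorphism R -> W}) op_im op_star opnorm.
Proof.
split.
- move=> t T; apply: ops_eq => x.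
    by rewrite !opE_mul !op_realE opZ.
  by rewrite [LHS]/= [RHS]/= opadjZ.
- move=> T; apply: ops_eq => x.
    by rewrite !opE_mul /= opZ.
  by rewrite [LHS]/= [RHS]/= opadjZ.
- apply: ops_eq => x.
    by rewrite opE_mul opE_opp opE_1 /= scalerA -expr2 sqrCi scaleN1r.
  rewrite opadjE_opp [LHS]/= scalerA conjCi mulrNN -expr2 sqrCi scaleN1r.
  by rewrite opadj_realE scale1r.
- by move=> S T; exact: ops_eq.
- by move=> S T; exact: ops_eq.
- by move=> T; exact: ops_eq.
- by move=> t; apply: ops_eq => x; rewrite /= conj_realC.
- apply: ops_eq => x.
    by rewrite opE_opp [LHS]/= conjCi scaleNr.
  by rewrite opadjE_opp /= conjCi scaleNr opprK.
- exact: opnorm_ge0.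
- move=> S T; apply: opnorm_le => [|x].
    by apply: addr_ge0; exact: opnorm_ge0.
  rewrite opE_add mulrDl; apply: (le_trans (pbarD Hf _ _)).
  by apply: lerD; exact: opnormP.
- move=> S T; apply: opnorm_le => [|x].
    by apply: mulr_ge0; exact: opnorm_ge0.
  rewrite opE_mul; apply: (le_trans (opnormP _ _)); rewrite -mulrA.
  by apply: ler_wpM2l; [exact: opnorm_ge0|exact: opnormP].
- by move=> t; apply: opnorm_le => // x; rewrite op_realE (pbarZ Hf).
- by apply: opnorm_le => // x; rewrite /= (pbarZi Hf) mul1r.
(* The C*-inequality: [f (T x) (T x)] is [f x] of [op_star T * T] at [x], and Cauchy-Schwarz brings
   in the norm of that product. *)
move=> T; set c := opnorm (op_star T * T).
have c0 : 0 <= c by exact: opnorm_ge0.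
have h : opnorm T <= Num.sqrt c.
  apply: opnorm_le => [|x]; first exact: sqrtr_ge0.
  have nx := pbar_ge0 p f x.
  apply: ler_of_sqr; first by rewrite mulr_ge0 // sqrtr_ge0.
  rewrite exprMn (sqr_sqrtr c0) (pbar_sqr Hf (op T x)) op_adjoint.
  apply: (le_trans (cs_ineq Hf _ _)).
  by have := opnormP (op_star T * T) x; rewrite opE_mul -/c /=; nra.
rewrite -(sqr_sqrtr c0); have := opnorm_ge0 T; nra.
Qed.

End Operators.

Section BoundedPair.
Variables (R : realType) (A : lmodType R[i]) (mul : A -> A -> A) (star : A -> A).
Variables (p : A -> R) (V : lmodType R[i]) (f : V -> V -> A).
Variable Hf : is_cs_form mul star p f.
Local Notation n := (pbar f p).
Variables (T T' : V -> V) (c : R).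
Hypotheses (linT : linear T) (linT' : linear T') (adjT : is_adjoint f T T').
Hypotheses (c0 : 0 <= c) (hT : forall x, n (T x) <= c * n x).

Definition bounded_ops : ops_of Hf :=
  @Ops _ _ _ _ _ _ _ Hf T T' linT linT' adjT (ex_intro2 _ _ c c0 hT).

Lemma opnorm_bounded_ops : opnorm bounded_ops <= c.
Proof. exact: opnorm_le. Qed.

End BoundedPair.

(** * Positivity for a C*-seminorm *)

Section RightMultiplication.
Variables (R : realType) (A : lmodType R[i]) (mul : A -> A -> A) (star : A -> A).
Hypothesis HA : is_star_algebra mul star.
Variable p : A -> R.
Hypothesis Hp : is_Cstar_seminorm mul star p.
Implicit Types a b e h k z : A.

Local Notation f := (fun a b => mul a (star b)).

Lemma pbar_regular a : pbar f p a = p a.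
Proof.
rewrite /pbar -{1}[a](starK HA) (sn_Cstar Hp) sqrtr_sqr (sn_star HA Hp).
by rewrite ger0_norm // (sn_ge0 Hp).
Qed.

Lemma regular_cs_form : is_cs_form mul star p f.
Proof.
split=> //.
- by move=> x y z; rewrite (mulDl HA).
- by move=> k x y; rewrite (mulZl HA).
- by move=> x y; rewrite (starM HA) (starK HA).
- move=> x y; rewrite !pbar_regular; apply: (le_trans (sn_submul Hp _ _)).
  by rewrite (sn_star HA Hp).
Qed.

Lemma rmul_linear a : linear (mul^~ a).
Proof. by move=> k x y; rewrite (mulDl HA) (mulZl HA). Qed.

Lemma rmul_adjoint a : is_adjoint f (mul^~ a) (mul^~ (star a)).
Proof. by move=> x y /=; rewrite (starM HA) (starK HA) (Defs.mulA HA). Qed.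

Lemma rmul_bound a z : pbar f p (mul z a) <= p a * pbar f p z.
Proof. by rewrite !pbar_regular mulrC; exact: (sn_submul Hp). Qed.

(** Places [A], which may lack a unit, isometrically in a unital algebra of operators. Products are
    reversed, which positivity does not notice. *)
Definition rmul a : ops_of regular_cs_form :=
  bounded_ops regular_cs_form (rmul_linear a) (rmul_linear (star a))
    (rmul_adjoint a) (sn_ge0 Hp a) (rmul_bound a).

Lemma rmulD a b : rmul (a + b) = rmul a + rmul b.
Proof.
apply: ops_eq => x /=; first by rewrite (mulDr HA).
by rewrite (starD HA) (mulDr HA).
Qed.

Definition sn_pos a := Pos (op_real regular_cs_form : {rmorphism R -> _})
  (@op_star _ _ _ _ _ _ _ _) (@opnorm _ _ _ _ _ _ _ _) (rmul a).

Let CW := ops_pre_cstar regular_cs_form.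

Lemma sn_posD a b : sn_pos a -> sn_pos b -> sn_pos (a + b).
Proof. by rewrite /sn_pos rmulD; exact: (PosD CW). Qed.

(** Right multiplication by [star e] followed by its adjoint is right multiplication by
    [mul (star e) e], so [Pos_starM] applies. *)
Lemma sn_pos_Apos a : Apos mul star a -> sn_pos a.
Proof.
move=> [e ->]; rewrite /sn_pos.
suff -> : rmul (mul (star e) e) = op_star (rmul (star e)) * rmul (star e).
  exact: (Pos_starM CW).
apply: ops_eq => x; rewrite [LHS]/= [RHS]/= ?(starM HA) ?(starK HA).
  by rewrite (Defs.mulA HA).
by rewrite (Defs.mulA HA).
Qed.

Lemma opnorm_rmul_le a : opnorm (rmul a) <= p a.
Proof. exact: opnorm_bounded_ops. Qed.

(** The C*-identity makes [star a] a vector at which the norm is attained. *)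
Lemma opnorm_rmul_ge a : p a <= opnorm (rmul a).
Proof.
have := opnormP (rmul a) (star a); rewrite !pbar_regular /= (sn_Cstar Hp).
rewrite (sn_star HA Hp); have := sn_ge0 Hp a; have := opnorm_ge0 (rmul a).
by move: (opnorm _) (p a) => x y *; nra.
Qed.

(** Monotonicity of [p] on positive elements: [p (h + k) - h] is the sum of the positive operators
    [p (h + k) - (h + k)] and [k]. *)
Lemma sn_le_addr h k : sn_pos h -> sn_pos k -> p h <= p (h + k).
Proof.
move=> Ph Pk; apply: (le_trans (opnorm_rmul_ge h)).
apply: (Pos_nu_le CW) => //; first exact: (sn_ge0 Hp).
have -> : op_real _ (p (h + k)) - rmul h =
    (op_real _ (p (h + k)) - rmul (h + k)) + rmul k.
  by rewrite rmulD opprD addrA subrK.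
apply: (PosD CW) => //; apply: (Pos_scB CW); last exact: opnorm_rmul_le.
by rewrite rmulD; exact: (saD CW Ph.1 Pk.1).
Qed.

Lemma AposZ t a : 0 <= t -> Apos mul star a -> Apos mul star ((t%:C)%C *: a).
Proof.
move=> t0 [e ->]; exists (((Num.sqrt t)%:C)%C *: e).
rewrite (star_algZ HA) (mulZl HA) (mulZr HA) scalerA -realCM -expr2.
by rewrite sqr_sqrtr.
Qed.

Lemma sn_Apos_sub a z t : Apos mul star a -> p a <= t ->
  p ((t%:C)%C *: z - mul z a) <= t * p z.
Proof.
move=> Pa hat; rewrite -!pbar_regular.
have ha : opnorm (rmul a) <= t by apply: le_trans hat; exact: opnorm_rmul_le.
have := Pos_bound CW (sn_pos_Apos Pa) ha => h.
have := opnormP (op_real _ t - rmul a) z.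
rewrite opE_add opE_opp op_realE /= => h2; apply: (le_trans h2).
by apply: ler_wpM2r => //; exact: pbar_ge0.
Qed.

End RightMultiplication.

(** * Hilbert modules *)

(** The optimal parameter is [y^-1]; when [y = 0], a large [t] forces [w = 0]. *)
Lemma ler_of_quadratic (R : realFieldType) (w x y : R) :
  0 <= w -> 0 <= x -> 0 <= y ->
  (forall t, 0 < t -> 2 * t * w <= x + t ^+ 2 * (w * y)) -> w <= x * y.
Proof.
move=> w0 x0; rewrite le_eqVlt => /predU1P[<-|yp] h.
  rewrite mulr0 leNgt; apply/negP => wp.
  have t0 : 0 < (x + 1) / w by apply: divr_gt0 => //; lra.
  have := h _ t0; rewrite !mulr0 addr0 -mulrA divfK ?gt_eqF //; lra.
have yV : 0 < y^-1 by rewrite invr_gt0.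
have := h _ yV.
have -> : y^-1 ^+ 2 * (w * y) = w * y^-1 by field; rewrite gt_eqF.
by move=> h1; rewrite -ler_pdivrMr //; lra.
Qed.

Section HilbertModule.
Variables (R : realType) (A : lmodType R[i]) (mul : A -> A -> A) (star : A -> A).
Variables (S : set (A -> R)) (X : lmodType R[i]) (act : A -> X -> X).
Variable ip : X -> X -> A.
Hypothesis HP : is_proC mul star S.
Hypothesis HX : is_hilbert_module mul star S act ip.
Let HA := proC_alg HP.
Implicit Types (p q : A -> R) (a b c : A) (x y z : X).

Lemma ipDr x y z : ip x (y + z) = ip x y + ip x z.
Proof. by rewrite !(ip_star HX _ x) (ipDl HX) (starD HA). Qed.

Lemma ipZr t x y : ip x ((t%:C)%C *: y) = (t%:C)%C *: ip x y.
Proof. by rewrite !(ip_star HX _ x) (ipZl HX) (star_algZ HA). Qed.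

Lemma ipNl x y : ip (- x) y = - ip x y.
Proof. by rewrite -scaleN1r (ipZl HX) scaleN1r. Qed.

Lemma ipNr x y : ip x (- y) = - ip x y.
Proof. by rewrite !(ip_star HX _ x) ipNl (star_algN HA). Qed.

Lemma ipBl x y z : ip (x - y) z = ip x z - ip y z.
Proof. by rewrite (ipDl HX) ipNl. Qed.

Lemma ipBr x y z : ip x (y - z) = ip x y - ip x z.
Proof. by rewrite ipDr ipNr. Qed.

Lemma ipAr a x y : ip x (act a y) = mul (ip x y) (star a).
Proof. by rewrite (ip_star HX) (ipAl HX) (starM HA) -(ip_star HX). Qed.

(** The discriminant argument with [z = x - t w y], where [w] is [ip x y]: positivity of [ip z z]
    and monotonicity of [p] turn the expansion into a quadratic inequality in [t]. *)
Lemma ip_cauchy_schwarz p x y : S p ->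
  p (ip x y) ^+ 2 <= p (ip x x) * p (ip y y).
Proof.
move=> Sp; have Hp := proC_sn HP Sp; set w := ip x y.
apply: ler_of_quadratic; rewrite ?sqr_ge0 ?(sn_ge0 Hp) // => t t0.
pose z := x - (t%:C)%C *: act w y.
pose b := mul w (star w); pose c := mul (mul w (ip y y)) (star w).
have zz : ((2 * t)%:C)%C *: b + ip z z = ip x x + ((t ^+ 2)%:C)%C *: c.
  have -> : ip z z = (ip x x - (t%:C)%C *: b) + (((t ^+ 2)%:C)%C *: c - (t%:C)%C *: b).
    rewrite /z ipBr !ipBl !ipZr !(ipZl HX) !(ipAl HX) !ipAr.
    rewrite [ip y x](ip_star HX) -/w -/b (Defs.mulA HA) -/c.
    by rewrite scalerA -realCM -expr2 opprB.
  have -> : 2 * t = t + t by ring.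
  by rewrite realCD scalerDl addrACA !(addrC ((t%:C)%C *: b)) !subrK.
have bE : b = mul (star (star w)) (star w) by rewrite (starK HA).
have pb : p b = p w ^+ 2 by rewrite bE (sn_Cstar Hp) (sn_star HA Hp).
have t20 : 0 <= 2 * t by lra.
have Pb : Apos mul star (((2 * t)%:C)%C *: b).
  by apply: (AposZ HA) => //; exists (star w).
have := sn_le_addr (sn_pos_Apos HA Hp Pb) (sn_pos_Apos HA Hp (ip_pos HX z)).
rewrite zz (snZ Hp) pb ger0_norm // => h; apply: (le_trans h).
apply: (le_trans (sn_triangle Hp _ _)); rewrite (snZ Hp) ger0_norm ?sqr_ge0 //.
rewrite lerD2l; apply: ler_wpM2l; first exact: sqr_ge0.
apply: (le_trans (sn_submul Hp _ _)); rewrite (sn_star HA Hp).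
have := sn_submul Hp w (ip y y); have := sn_ge0 Hp w; nra.
Qed.

Lemma hilbert_cs_form p : S p -> is_cs_form mul star p ip.
Proof.
move=> Sp; have Hp := proC_sn HP Sp; split=> //.
- exact: (ipDl HX).
- exact: (ipZl HX).
- exact: (ip_star HX).
- move=> x y; apply: ler_of_sqr; first by rewrite mulr_ge0 // sqrtr_ge0.
  rewrite exprMn !sqr_sqrtr ?(sn_ge0 Hp) //; exact: ip_cauchy_schwarz.
Qed.

Lemma pbar_act p a x : S p -> pbar ip p (act a x) <= p a * pbar ip p x.
Proof.
move=> Sp; have Hp := proC_sn HP Sp; have Hf := hilbert_cs_form Sp.
have pa := sn_ge0 Hp a.
apply: ler_of_sqr; first by rewrite mulr_ge0 // sqrtr_ge0.
rewrite exprMn !(pbar_sqr Hf) (ipAl HX) ipAr.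
apply: (le_trans (sn_submul Hp _ _)).
have := sn_submul Hp (ip x x) (star a); rewrite (sn_star HA Hp); nra.
Qed.

Lemma pbar_eq0 x : (forall p, S p -> pbar ip p x = 0) -> x = 0.
Proof.
move=> h; apply: (ip_def HX); apply: (proC_sep HP) => p Sp.
by rewrite -(pbar_sqr (hilbert_cs_form Sp)) h // expr0n.
Qed.

Lemma ip_nondeg y : (forall x, ip x y = 0) -> y = 0.
Proof. by move=> h; apply: (ip_def HX). Qed.

Lemma adjoint_linear (T T' : X -> X) : is_adjoint ip T T' -> linear T'.
Proof.
move=> h k x y; apply/eqP; rewrite -subr_eq0; apply/eqP/ip_nondeg => z.
have Hf0 : forall z u v, ip z (k *: u + v) = k^* *: ip z u + ip z v.
  by move=> z' u v; rewrite ipDr !(ip_star HX _ z') (ipZl HX) (starZ HA).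
by rewrite ipBr Hf0 -!h Hf0 subrr.
Qed.

Lemma S_zero : S (fun=> 0).
Proof.
apply: (proC_all HP).
  by split=> // *; rewrite ?addr0 ?mulr0 ?mul0r ?expr0n.
exists 0%N, (fun i a => 0); split; first by case.
by exists 1 => // a; rewrite mul1r big_ord0.
Qed.

(** The maximum of two C*-seminorms is one again and is dominated by their sum, so [proC_all]
    applies. It makes [S] directed: one seminorm can stand in for finitely many. *)
Lemma S_max p q : S p -> S q -> S (fun a => Num.max (p a) (q a)).
Proof.
move=> Sp Sq; have Hp := proC_sn HP Sp; have Hq := proC_sn HP Sq.
apply: (proC_all HP).
  split.
  - by move=> a; rewrite le_max (sn_ge0 Hp).
  - move=> a b; rewrite ge_max; apply/andP; split.
      apply: (le_trans (sn_triangle Hp _ _)).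
      by apply: lerD; rewrite le_max lexx.
    apply: (le_trans (sn_triangle Hq _ _)).
    by apply: lerD; rewrite le_max lexx orbT.
  - move=> k a; have := sn_homog Hp k a; have := sn_homog Hq k a.
    rewrite normc_def -!realCM => /(@complexI R) -> /(@complexI R) ->.
    by rewrite -maxr_pMr // sqrtr_ge0.
  - move=> a b; rewrite ge_max; apply/andP; split.
      apply: (le_trans (sn_submul Hp _ _)).
      by apply: ler_pM; rewrite ?(sn_ge0 Hp) // le_max lexx.
    apply: (le_trans (sn_submul Hq _ _)).
    by apply: ler_pM; rewrite ?(sn_ge0 Hq) // le_max lexx orbT.
  - move=> a; rewrite (sn_Cstar Hp) (sn_Cstar Hq).
    have := sn_ge0 Hp a; have := sn_ge0 Hq a; move: (p a) (q a) => u v v0 u0.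
    have [uv|vu] := leP u v.
      by apply: max_r; rewrite ler_pXn2r.
    by apply: max_l; rewrite ler_pXn2r // ltW.
exists 2%N, (fun i => if i == ord0 then p else q); split.
  by move=> i; case: ifP.
exists 1 => // a; rewrite mul1r big_ord_recl big_ord1 /=.
by rewrite ge_max lerDl lerDr (sn_ge0 Hp) (sn_ge0 Hq).
Qed.

Lemma S_ub (n : nat) (ps : 'I_n -> A -> R) : (forall i, S (ps i)) ->
  exists2 q, S q & forall i a, ps i a <= q a.
Proof.
elim: n ps => [|n ih] ps hps; first by exists (fun=> 0); [exact: S_zero|case].
have [i|q Sq hq] := ih (fun i => ps (lift ord0 i)); first exact: hps.
exists (fun a => Num.max (ps ord0 a) (q a)); first exact: S_max.
move=> i a; case: (unliftP ord0 i) => [j ->|->]; rewrite le_max ?lexx //.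
by rewrite hq orbT.
Qed.

Lemma pbar_mono p q x : (forall a, p a <= q a) -> pbar ip p x <= pbar ip q x.
Proof. by move=> h; rewrite /pbar ler_wsqrtr. Qed.

Lemma in_closureP (E : set X) x : in_closure S ip E x <->
  forall p, S p -> forall e : R, 0 < e -> exists2 y, E y & pbar ip p (x - y) < e.
Proof.
split=> [h p Sp e e0|h n ps hps e e0].
  have [y Ey hy] := h 1%N (fun=> p) (fun=> Sp) e e0.
  by exists y => //; exact: (hy ord0).
have [q Sq hq] := S_ub hps; have [y Ey hy] := h q Sq e e0.
by exists y => // i; apply: le_lt_trans hy; exact: pbar_mono.
Qed.

End HilbertModule.

(** * Operators on Hilbert modules *)

Section HilbertOperators.
Variables (R : realType) (A : lmodType R[i]) (mul : A -> A -> A) (star : A -> A).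
Variables (S : set (A -> R)) (X : lmodType R[i]) (act : A -> X -> X).
Variable ip : X -> X -> A.
Hypothesis HP : is_proC mul star S.
Hypothesis HX : is_hilbert_module mul star S act ip.
Let HA := proC_alg HP.
Implicit Types (p q : A -> R) (a b c : A) (x y z : X).

Lemma hilbert_complete (F : set_system X) : ProperFilter F ->
  (forall p, S p -> forall e : R, 0 < e ->
     exists2 U, F U & forall x y, U x -> U y -> pbar ip p (x - y) < e) ->
  exists l : X, forall p, S p -> forall e : R, 0 < e ->
     exists2 U, F U & forall x, U x -> pbar ip p (x - l) < e.
Proof.
move=> FF h; have [|l hl] := hm_complete HX FF.
  by move=> _ [p Sp ->] e e0; exact: h.
by exists l => p Sp e e0; apply: hl => //; exists p.
Qed.

(** The approximate solutions depend on the seminorm, so they are gathered in a filter instead of a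
    sequence. The lower bound makes the filter Cauchy, the upper bound lets [L] pass to the
    limit. *)
Lemma solve_of_bounded_below (L : X -> X) y :
  (forall u v, L (u - v) = L u - L v) ->
  (forall p, S p -> exists2 c : R, 0 < c &
    forall z, pbar ip p z <= c * pbar ip p (L z)) ->
  (forall p, S p -> exists2 c : R, 0 < c &
    forall z, pbar ip p (L z) <= c * pbar ip p z) ->
  (forall p, S p -> forall e : R, 0 < e -> exists z, pbar ip p (L z - y) < e) ->
  exists z, L z = y.
Proof.
move=> LB below above approx.
pose F : set_system X := fun U => exists2 q, S q & exists2 d : R, 0 < d &
  forall z, pbar ip q (L z - y) < d -> U z.
have FF : ProperFilter F.
  split.
    move=> [q Sq [d d0 h]]; have [z hz] := approx q Sq d d0; exact: h hz.
  split.
  - by exists (fun=> 0); [exact: (S_zero HP)|exists 1].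
  - move=> U V [q Sq [d d0 h]] [q' Sq' [d' d0' h']].
    exists (fun a => Num.max (q a) (q' a)); first exact: (S_max HP).
    exists (Num.min d d'); first by rewrite lt_min d0.
    move=> z; rewrite lt_min => /andP[h1 h2]; split.
      by apply: h; apply: le_lt_trans h1; apply: pbar_mono => a; rewrite le_max lexx.
    by apply: h'; apply: le_lt_trans h2; apply: pbar_mono => a; rewrite le_max lexx orbT.
  - by move=> U V UV [q Sq [d d0 h]]; exists q => //; exists d => // z /h /UV.
have [|z hz] := hilbert_complete FF.
  move=> p Sp e e0; have [c c0 hc] := below p Sp.
  have d0 : 0 < e / c / 2 by rewrite !divr_gt0.
  exists [set z | pbar ip p (L z - y) < e / c / 2].
    by exists p => //; exists (e / c / 2).
  move=> u v /= hu hv; apply: (le_lt_trans (hc _)).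
  rewrite mulrC -ltr_pdivlMr // LB; have Hf := hilbert_cs_form HP HX Sp.
  have -> : L u - L v = (L u - y) - (L v - y) by rewrite opprB addrA subrK.
  by have := pbarB Hf (L u - y) (L v - y); lra.
exists z; apply/eqP; rewrite -subr_eq0; apply/eqP/(pbar_eq0 HP HX) => p Sp.
have Hf := hilbert_cs_form HP HX Sp.
apply/le_anti/andP; split; last exact: pbar_ge0.
apply: le_eps => e e0; rewrite add0r.
have [c c0 hc] := above p Sp.
have e1 : 0 < e / 2 / c by rewrite !divr_gt0.
have [U [q Sq [d d0 hU]] hUz] := hz p Sp _ e1.
have d'0 : 0 < Num.min d (e / 2) by rewrite lt_min d0 divr_gt0.
(* One [u] serves twice: its [q]-estimate puts it in [U], close to [z], and its [p]-estimate puts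
   [L u] close to [y]. *)
have [u] := approx _ (S_max HP Sp Sq) _ d'0.
rewrite lt_min => /andP[h1 h2].
have Uu : U u.
  by apply: hU; apply: le_lt_trans h1; apply: pbar_mono => a; rewrite le_max lexx orbT.
have h3 : pbar ip p (L u - y) < e / 2.
  by apply: le_lt_trans h2; apply: pbar_mono => a; rewrite le_max lexx.
have h4 := hUz u Uu; have h5 := hc (u - z).
have h6 : pbar ip p (L u - L z) <= e / 2.
  rewrite -LB; apply: (le_trans h5); rewrite mulrC -ler_pdivlMr //; exact: ltW.
have -> : L z - y = (L u - y) - (L u - L z) by rewrite opprB [RHS]addrC addrA subrK.
by have := pbarB Hf (L u - y) (L u - L z); lra.
Qed.

(** The frame series of [T xi] at [x] is that of [xi] at [T' x]. The lower bound of the first and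
    the upper bound of the second enclose the same sum, whence the constant [sqrt (b / a)]. *)
Lemma frame_dominates (T T' Kadj : X -> X) (xi : nat -> X) :
  is_adjoint ip T T' -> K_frame mul star S ip Kadj xi ->
  K_frame mul star S ip Kadj (fun i => T (xi i)) ->
  exists2 c : R, 0 <= c & forall p, S p -> forall x,
    pbar ip p (Kadj x) <= c * pbar ip p (T' x).
Proof.
move=> adjT [_ [a' [b [_ b0 hb]]]] [hsum [a [b' [a0 _ ha]]]].
exists (Num.sqrt (b / a)); first exact: sqrtr_ge0.
move=> p Sp x; have Hp := proC_sn HP Sp; have Hf := hilbert_cs_form HP HX Sp.
have [l hl] := hsum x; have [hKl _] := ha x l hl.
have seriesE : (fun i => mul (ip x (T (xi i))) (ip (T (xi i)) x)) =
    (fun i => mul (ip (T' x) (xi i)) (ip (xi i) (T' x))).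
  by apply/funext => i; rewrite adjT -(adjoint_sym Hf adjT).
have [_ hlT] := hb (T' x) l ltac:(by rewrite -seriesE).
have ba : 0 <= b / a by rewrite divr_ge0 // ltW.
apply: ler_of_sqr; first by rewrite mulr_ge0 ?sqrtr_ge0.
rewrite exprMn (sqr_sqrtr ba) !(pbar_sqr Hf) mulrAC ler_pdivlMr // mulrC.
have PK : Apos mul star ((a%:C)%C *: ip (Kadj x) (Kadj x)).
  by apply: (AposZ HA); [exact: ltW|exact: (ip_pos HX)].
have := sn_le_addr (sn_pos_Apos HA Hp PK)
  (sn_posD (sn_pos_Apos HA Hp hKl) (sn_pos_Apos HA Hp hlT)).
by rewrite addrA (addrC (_ *: _)) subrK addrC subrK !(snZ Hp) !gtr0_norm.
Qed.

Lemma dense_of_dominated p (T T' K K' : X -> X) (c d : R) : S p ->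
  linear T -> is_adjoint ip T T' -> is_adjoint ip K K' ->
  0 < d -> (forall x, pbar ip p (T x) <= d * pbar ip p x) ->
  0 <= c -> (forall x, pbar ip p (K' x) <= c * pbar ip p (T' x)) ->
  (forall x (e : R), 0 < e -> exists v, pbar ip p (x - K v) < e) ->
  forall x (e : R), 0 < e -> exists u, pbar ip p (x - T u) < e.
Proof.
move=> Sp linT adjT adjK d0 hT c0 hK denseK x e e0.
have Hf := hilbert_cs_form HP HX Sp; have CW := ops_pre_cstar Hf.
have linT' := adjoint_linear HP HX adjT.
have hT' := adjoint_bound Hf (ltW d0) adjT hT.
(* [B] is [T'] with adjoint [T], so [op_star B * B] is [T T'], and [s] scales it to norm at most
   [1]. *)
pose B := bounded_ops Hf linT' linT (adjoint_sym Hf adjT) (ltW d0) hT'.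
pose s := (d ^+ 2)^-1; have s0 : 0 < s by rewrite invr_gt0 exprn_gt0.
have sd : s * d ^+ 2 = 1 by rewrite mulVf // gt_eqF // exprn_gt0.
pose g := op_real Hf s * (op_star B * B).
have Pg : Pos (op_real Hf : {rmorphism R -> ops_of Hf})
    (@op_star _ _ _ _ _ _ _ Hf) (@opnorm _ _ _ _ _ _ _ Hf) g.
  by apply: (PosZ CW (ltW s0)); exact: (Pos_starM CW).
have ng : opnorm g <= 1.
  apply: (le_trans (nuZ CW _ (ltW s0))); rewrite -sd.
  apply: ler_wpM2l; first exact: ltW.
  apply: (le_trans (nuM CW _ _)); rewrite (nu_star CW) expr2.
  have hB : opnorm B <= d by exact: opnorm_bounded_ops.
  by apply: ler_pM => //; exact: opnorm_ge0.
pose D := 1 - g.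
have PD := Pos_scB CW Pg.1 ng; rewrite rmorph1 -/D in PD.
have saD N : opadj (D ^+ N) =1 op (D ^+ N).
  by move=> z; have {2}<- := saX CW N PD.1.
have opg z : op g z = (s%:C)%C *: T (T' z) by [].
have T0Z k z : T (k *: z) = k *: T z.
  have T0 : T 0 = 0 by have := linT (-1) 0 0; rewrite scaleN1r addNr scaleN1r addNr.
  by have := linT k z 0; rewrite !addr0 T0 addr0.
have TD u v : T (u + v) = T u + T v by have := linT 1 u v; rewrite !scale1r.
have rangeD N y : exists u, y - op (D ^+ N) y = T u.
  elim: N => [|N [u hu]].
    exists 0; rewrite expr0 opE_1 subrr; symmetry.
    by have := T0Z 0 0; rewrite !scale0r.
  exists (u + (s%:C)%C *: T' (op (D ^+ N) y)).
  rewrite TD -hu T0Z exprS opE_mul /D opE_add opE_1 opE_opp opg.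
  by rewrite opprD opprK addrA.
(* For [v = D ^+ M y], the square of the seminorm of [T' v] is that of [ip (T (T' v)) v], and
   [T (T' v)] is [g v] up to the factor [s], where [Pos_decay] applies. *)
have decay M y :
    M%:R * pbar ip p (T' (op (D ^+ M) y)) ^+ 2 <= d ^+ 2 * pbar ip p y ^+ 2.
  have h1 := Pos_decay CW M Pg PD.
  have h2 := opnormP (g * D ^+ M) y; rewrite opE_mul opg (pbarZ Hf) gtr0_norm // in h2.
  have h3 : pbar ip p (op (D ^+ M) y) <= pbar ip p y.
    have nD : opnorm (D ^+ M) <= 1.
      elim: M {h1 h2} => [|M ih]; first exact: (nu1 CW).
      rewrite exprS; apply: (le_trans (nuM CW _ _)).
      have := Pos_bound CW Pg ng; rewrite rmorph1 -/D => nD.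
      by rewrite -[leRHS](mul1r 1); apply: ler_pM => //; exact: opnorm_ge0.
    by apply: (le_trans (opnormP _ _)); rewrite -[leRHS]mul1r ler_wpM2r // pbar_ge0.
  have h4 := cs_ineq Hf (T (T' (op (D ^+ M) y))) (op (D ^+ M) y).
  rewrite adjT -(pbar_sqr Hf) in h4.
  have ny := pbar_ge0 p ip y; have nDy := pbar_ge0 p ip (op (D ^+ M) y).
  have nT := pbar_ge0 p ip (T (T' (op (D ^+ M) y))).
  rewrite -ler_pdivrMl ?exprn_gt0 // -/s.
  apply: (@le_trans _ _ (s * (M%:R * (pbar ip p (T (T' (op (D ^+ M) y))) * pbar ip p y)))).
    apply: ler_wpM2l; first exact: ltW.
    by apply: ler_wpM2l => //; apply: (le_trans h4); exact: ler_wpM2l.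
  have -> : forall m u v : R, s * (m * (u * v)) = m * (s * u) * v by move=> *; ring.
  rewrite expr2; apply: ler_wpM2r => //.
  apply: (@le_trans _ _ (M%:R * (opnorm (g * D ^+ M) * pbar ip p y))).
    exact: ler_wpM2l.
  by rewrite mulrA -[leRHS]mul1r; apply: ler_wpM2r.
have e20 : 0 < e / 2 by rewrite divr_gt0.
have [v hv] := denseK x _ e20.
pose C := c * pbar ip p v; pose Y := pbar ip p (K v).
have nv := pbar_ge0 p ip v; have nY : 0 <= Y := pbar_ge0 p ip (K v).
have C0 : 0 <= C by rewrite mulr_ge0.
pose b : R := (e / 2) ^+ 2; have b0 : 0 < b by rewrite exprn_gt0.
(* This brings [C * d * Y / sqrt N] below [b]; the successor keeps [N] positive. *)
pose N := (Num.bound ((C * (d * Y)) ^+ 2 / b ^+ 2)).+1.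
have hN : (C * (d * Y)) ^+ 2 < b ^+ 2 * N%:R.
  rewrite [ltRHS]mulrC -ltr_pdivrMr ?exprn_gt0 //.
  apply: (@lt_le_trans _ _ (Num.bound ((C * (d * Y)) ^+ 2 / b ^+ 2))%:R).
    by apply: archi_boundP; rewrite divr_ge0 // sqr_ge0.
  by rewrite ler_nat.
have [u hu] := rangeD N (K v); exists u.
have -> : x - T u = (x - K v) + op (D ^+ N) (K v).
  by rewrite -hu opprB [op _ _ - _]addrC addrA.
apply: (le_lt_trans (pbarD Hf _ _)).
suff : pbar ip p (op (D ^+ N) (K v)) <= e / 2 by lra.
apply: ler_of_sqr; first exact: ltW.
(* Moving one [D ^+ N] and then [K] across the inner product turns the square of the seminorm of
   [D ^+ N (K v)] into a pairing of [v] with [K'] of a decaying vector, where the domination of [K']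
   is usable. *)
have := cs_ineq Hf v (K' (op (D ^+ (N + N)) (K v))).
rewrite -adjK exprD opE_mul -[in X in ip _ X]saD -op_adjoint -(pbar_sqr Hf).
move=> h; apply: (le_trans h); rewrite -opE_mul -exprD.
have h1 := hK (op (D ^+ (N + N)) (K v)); have h2 := decay (N + N)%N (K v).
set Q := pbar ip p (T' _) in h1 h2; have Q0 : 0 <= Q := pbar_ge0 _ _ _.
apply: (@le_trans _ _ (C * Q)).
  by rewrite /C [c * _]mulrC -mulrA; exact: ler_wpM2l.
apply: ler_of_sqr; first exact: ltW.
have N0 : (0 : R) < N%:R by rewrite ltr0n.
rewrite -(ler_pM2r N0); apply: le_trans (ltW hN).
rewrite exprMn -mulrA [(C * _) ^+ 2]exprMn; apply: ler_wpM2l; first exact: sqr_ge0.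
rewrite exprMn; apply: le_trans h2; rewrite mulrC; apply: ler_wpM2r.
  exact: sqr_ge0.
by rewrite ler_nat leq_addr.
Qed.

End HilbertOperators.

(** * Resolvents of positive elements and mollified vectors *)

Section BoundedBelow.
Variables (R : realType) (A : lmodType R[i]) (mul : A -> A -> A) (star : A -> A).
Variables (S : set (A -> R)) (X : lmodType R[i]) (act : A -> X -> X).
Variable ip : X -> X -> A.
Hypothesis HP : is_proC mul star S.
Hypothesis HX : is_hilbert_module mul star S act ip.
Let HA := proC_alg HP.
Implicit Types (p q : A -> R) (a b c : A) (x y z : X).

(** With [t = p a], the products of [w] by [e + a] and by [t - a] add up to [(e + t) w], and the
    second has size at most [t * p w]. *)
Lemma sn_Apos_ge p a w e : S p -> Apos mul star a ->
  0 <= e -> e * p w <= p ((e%:C)%C *: w + mul w a).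
Proof.
move=> Sp Pa e0; have Hp := proC_sn HP Sp; pose t := p a.
have t0 : 0 <= t := sn_ge0 Hp a.
have h := sn_Apos_sub HA Hp w Pa (lexx t).
have := sn_triangle Hp ((e%:C)%C *: w + mul w a) ((t%:C)%C *: w - mul w a).
rewrite addrACA subrr addr0 -scalerDl -realCD (snZ Hp) ger0_norm ?addr_ge0 //.
by rewrite mulrDl; lra.
Qed.

Lemma Apos_star a : Apos mul star a -> star a = a.
Proof. by move=> [e ->]; rewrite (starM HA) (starK HA). Qed.

Lemma Apos_cancel a w (e : R) : Apos mul star a -> 0 < e ->
  (e%:C)%C *: w + mul w a = 0 -> w = 0.
Proof.
move=> Pa e0 h; apply: (proC_sep HP) => p Sp; have Hp := proC_sn HP Sp.
have := sn_Apos_ge w Sp Pa (ltW e0); rewrite h (sn0 Hp).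
have := sn_ge0 Hp w; move: (p w) => u u0 hu.
by apply/le_anti/andP; split=> //; rewrite -(pmulr_rle0 _ e0).
Qed.

(** Writing [ip z z] as [mul (star d) d] reduces the claim to [A]: the inner square of [(t - a) z]
    is [mul (star w) w] with [w = d (t - a)]. *)
Lemma act_Apos_sub p a z (t : R) : S p -> Apos mul star a -> p a <= t ->
  pbar ip p ((t%:C)%C *: z - act a z) <= t * pbar ip p z.
Proof.
move=> Sp Pa hat; have Hp := proC_sn HP Sp; have [d zz] := ip_pos HX z.
have -> : pbar ip p z = p d.
  by rewrite /pbar zz (sn_Cstar Hp) sqrtr_sqr ger0_norm // (sn_ge0 Hp).
suff -> : pbar ip p ((t%:C)%C *: z - act a z) = p ((t%:C)%C *: d - mul d a).
  exact: (sn_Apos_sub HA Hp).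
set w := (t%:C)%C *: d - mul d a.
suff ww : ip ((t%:C)%C *: z - act a z) ((t%:C)%C *: z - act a z) = mul (star w) w.
  by rewrite /pbar ww (sn_Cstar Hp) sqrtr_sqr ger0_norm // (sn_ge0 Hp).
rewrite (ipBl HX) !(ipBr HP HX) !(ipZl HX) !(ipZr HP HX) !(ipAl HX) !(ipAr HP HX).
rewrite zz (Apos_star Pa) /w (star_algB HA) (star_algZ HA) (starM HA) (Apos_star Pa).
rewrite (mulBl HA) !(mulBr HA) !(mulZl HA) !(mulZr HA) !(Defs.mulA HA).
by [].
Qed.

(* The resolvent equation is solved by Richardson iteration for one seminorm
   at a time. *)
Lemma resolvent a x (e : R) : Apos mul star a -> 0 < e ->
  exists z, (e%:C)%C *: z + act a z = x.
Proof.
move=> Pa e0; pose L z := (e%:C)%C *: z + act a z.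
have actN u : act a (- u) = - act a u.
  by rewrite -scaleN1r (actZr HX) scaleN1r.
have LD u v : L (u + v) = L u + L v.
  by rewrite /L scalerDr (actDr HX) addrACA.
have LN u : L (- u) = - L u by rewrite /L scalerN actN opprD.
have LZ (t : R) u : L ((t%:C)%C *: u) = (t%:C)%C *: L u.
  by rewrite /L (actZr HX) scalerDr !scalerA mulrC.
apply: (solve_of_bounded_below HP HX (L := L)).
- by move=> u v; rewrite LD LN.
- move=> p Sp; have Hf := hilbert_cs_form HP HX Sp; have Hp := proC_sn HP Sp.
  exists e^-1; first by rewrite invr_gt0.
  move=> z; rewrite mulrC ler_pdivlMr // mulrC.
  have t0 := sn_ge0 Hp a; have h := act_Apos_sub z Sp Pa (lexx (p a)).
  have := pbarD Hf (L z) (((p a)%:C)%C *: z - act a z).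
  rewrite /L addrACA subrr addr0 -scalerDl -realCD (pbarZ Hf).
  by rewrite (ger0_norm (addr_ge0 (ltW e0) (sn_ge0 Hp a))) mulrDl; lra.
- move=> p Sp; have Hf := hilbert_cs_form HP HX Sp; have Hp := proC_sn HP Sp.
  exists (e + p a); first by have := sn_ge0 Hp a; lra.
  move=> z; apply: (le_trans (pbarD Hf _ _)); rewrite (pbarZ Hf) gtr0_norm //.
  by rewrite mulrDl lerD2l; exact: (pbar_act HP HX).
move=> p Sp d d0; have Hf := hilbert_cs_form HP HX Sp; have Hp := proC_sn HP Sp.
have pa := sn_ge0 Hp a; pose t := p a + 1; have t0 : 0 < t by rewrite /t; lra.
have te0 : 0 < t + e by lra.
pose k := t / (t + e).
(* The residual after one iteration is [(t - a) r / (t + e)], so it contracts by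
   [k = t / (t + e)]. *)
have contr r : pbar ip p (r - (((t + e)^-1)%:C)%C *: L r) <= k * pbar ip p r.
  have -> : r - (((t + e)^-1)%:C)%C *: L r =
      (((t + e)^-1)%:C)%C *: ((t%:C)%C *: r - act a r).
    have {1}-> : r = (((t + e)^-1)%:C)%C *: (((t + e)%:C)%C *: r).
      by rewrite scalerA -realCM mulVf ?gt_eqF // scale1r.
    rewrite -scalerBr /L realCD scalerDl opprD addrACA addrA.
    by rewrite subrK.
  rewrite (pbarZ Hf) gtr0_norm ?invr_gt0 // /k mulrC mulrAC.
  apply: ler_wpM2r; first by rewrite invr_ge0 ltW.
  by apply: act_Apos_sub => //; rewrite /t; lra.
have iterate m : exists z, pbar ip p (x - L z) <= k ^+ m * pbar ip p x.
  elim: m => [|m [z hz]].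
    exists 0; have -> : L 0 = 0 by have := LZ 0 0; rewrite !scale0r.
    by rewrite subr0 expr0 mul1r.
  pose r := x - L z; exists (z + (((t + e)^-1)%:C)%C *: r).
  rewrite LD LZ opprD addrA -/r exprS -mulrA.
  apply: (le_trans (contr r)); apply: ler_wpM2l => //.
  by rewrite /k divr_ge0 // ltW.
pose M := pbar ip p x; have M0 : 0 <= M := pbar_ge0 _ _ _.
pose m := Num.bound (M / d / (e / t)).
have et0 : 0 < e / t by rewrite divr_gt0.
have [z hz] := iterate m; exists z; rewrite (pbarBC Hf).
apply: (le_lt_trans hz); rewrite -/M.
have kE : k = (1 + e / t)^-1.
  by rewrite /k; field; rewrite !gt_eqF //; lra.
rewrite kE exprVn mulrC ltr_pdivrMr ?exprn_gt0 //; last by lra.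
rewrite mulrC -ltr_pdivrMr //.
have : M / d < m%:R * (e / t).
  rewrite -ltr_pdivrMr //; apply: archi_boundP.
  by rewrite !divr_ge0 // ltW.
have := bernoulli m (ltW et0); lra.
Qed.

(** The vector is [x' = e z] with [z = (e + a)^-1 x]. Formally [u = a (e + a)^-1] and
    [c = a (e + a)^-2], so that [e c + u u = u]; this bounds [u] by [1] and [c] by [1 / e] for every
    seminorm. Also [x - x' = a z]. *)
Lemma mollify (T : X -> X) x (e : R) :
  (forall u v, T (u + v) = T u + T v) ->
  (forall (k : R[i]) u, T (k *: u) = k *: T u) ->
  (forall a u, T (act a u) = act a (T u)) -> 0 < e ->
  exists x', (forall q, S q -> pbar ip q (T x') ^+ 2 <= e) /\
    forall p, S p -> e * pbar ip p (x - x') <= pbar ip p (T x) ^+ 2 * pbar ip p x.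
Proof.
move=> TD TZ TA e0; pose a := ip (T x) (T x).
have Pa : Apos mul star a := ip_pos HX _.
have saa := Apos_star Pa.
have [z hz] := resolvent x Pa e0; pose E := (e%:C)%C.
exists (E *: z); split=> [q Sq|p Sp].
  have Hf := hilbert_cs_form HP HX Sq; have Hq := proC_sn HP Sq.
  pose v := T z; pose c := ip v v.
  have [u uDef] : exists u, u = E *: c + mul a c by exists (E *: c + mul a c).
  have yE : T x = E *: v + act a v by rewrite -hz TD TZ TA.
  have uE : ip (T x) v = u by rewrite uDef yE (ipDl HX) (ipZl HX) (ipAl HX).
  have sac : star c = c := Apos_star (ip_pos HX v).
  have aE : a = E *: u + mul u a.
    rewrite {1}/a {2}yE (ipDr HP HX) (ipZr HP HX) (ipAr HP HX) uE.
    by rewrite saa.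
  have aE' : a = E *: star u + mul a (star u).
    by rewrite -{1}saa {1}aE (starD HA) (star_algZ HA) (starM HA) saa.
  (* The inverse of [e + a] need not exist in [A], so identities are proved by cancelling [e + a] on
     the right; here both sides become [mul a a]. *)
  have cau : mul a u = mul u a.
    apply/eqP; rewrite -subr_eq0; apply/eqP; apply: (Apos_cancel Pa e0).
    rewrite (mulBl HA) scalerBr addrACA -opprD.
    have -> : E *: mul a u + mul (mul a u) a = mul a a.
      transitivity (mul a (E *: u + mul u a)); last by rewrite -aE.
      by rewrite (mulDr HA) (mulZr HA) (Defs.mulA HA).
    have -> : E *: mul u a + mul (mul u a) a = mul a a.
      transitivity (mul (E *: u + mul u a) a); last by rewrite -aE.
      by rewrite (mulDl HA) (mulZl HA).
    by rewrite subrr.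
  have sau : star u = u.
    symmetry; apply/eqP; rewrite -subr_eq0; apply/eqP; apply: (Apos_cancel Pa e0).
    rewrite (mulBl HA) scalerBr addrACA -opprD -aE.
    have -> : mul (star u) a = mul a (star u).
      by rewrite -{1}saa -(starM HA) cau (starM HA) saa.
    by rewrite -aE' subrr.
  (* Multiplied by [e + a], both sides become [mul a u]. *)
  have uu : mul a c = mul u u.
    have cac : mul c a = mul a c.
      have := sau; rewrite uDef (starD HA) (star_algZ HA) (starM HA) sac saa.
      by move/addrI.
    apply/eqP; rewrite -subr_eq0; apply/eqP; apply: (Apos_cancel Pa e0).
    have -> : mul (mul a c - mul u u) a = mul a (mul a c - mul u u).
      rewrite (mulBl HA) (mulBr HA) -!(Defs.mulA HA) cac -cau.
      by rewrite [mul u (mul a u)](Defs.mulA HA) -cau -(Defs.mulA HA).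
    rewrite (mulBr HA) scalerBr addrACA -opprD.
    have -> : E *: mul a c + mul a (mul a c) = mul a u.
      by rewrite uDef (mulDr HA) (mulZr HA).
    have -> : E *: mul u u + mul a (mul u u) = mul a u.
      transitivity (mul (E *: u + mul u a) u); last by rewrite -aE.
      by rewrite -cau (mulDl HA) (mulZl HA) (Defs.mulA HA).
    by rewrite subrr.
  (* Both summands on the left are positive, so monotonicity gives [q u ^+ 2 <= q u] and
     [e * q c <= q u]. *)
  have uD : E *: c + mul (star u) u = u by rewrite sau -uu -uDef.
  have Pc : Apos mul star (E *: c) by apply: (AposZ HA (ltW e0)); exact: (ip_pos HX).
  have Puu : Apos mul star (mul (star u) u) by exists u.
  have h1 := sn_le_addr (sn_pos_Apos HA Hq Pc) (sn_pos_Apos HA Hq Puu).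
  have h2 := sn_le_addr (sn_pos_Apos HA Hq Puu) (sn_pos_Apos HA Hq Pc).
  rewrite addrC uD (sn_Cstar Hq) in h2; rewrite uD (snZ Hq) gtr0_norm // in h1.
  have qu := sn_ge0 Hq u; have u1 : q u <= 1 by nra.
  rewrite TZ -/v.
  rewrite (pbarZ Hf) gtr0_norm // exprMn (pbar_sqr Hf) -/c expr2 -mulrA.
  by rewrite -[leRHS]mulr1 ler_pM2l //; lra.
have Hf := hilbert_cs_form HP HX Sp; have Hp := proC_sn HP Sp.
have hz' : e * pbar ip p z <= pbar ip p x.
  have h := act_Apos_sub z Sp Pa (lexx (p a)); have pa := sn_ge0 Hp a.
  have := pbarD Hf x (((p a)%:C)%C *: z - act a z).
  rewrite -{1}hz addrACA subrr addr0 -scalerDl -realCD (pbarZ Hf).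
  by rewrite (ger0_norm (addr_ge0 (ltW e0) (sn_ge0 Hp a))) mulrDl; lra.
have -> : x - E *: z = act a z by rewrite -hz addrC addrA addNr add0r.
rewrite (pbar_sqr Hf) -/a; have := pbar_act HP HX a z Sp.
have := sn_ge0 Hp a; have := pbar_ge0 p ip z; nra.
Qed.

End BoundedBelow.

(** * Lower bounds for surjective operators *)

Section Surjective.
Variables (R : realType) (A : lmodType R[i]) (mul : A -> A -> A) (star : A -> A).
Variables (S : set (A -> R)) (X : lmodType R[i]) (act : A -> X -> X).
Variable ip : X -> X -> A.
Hypothesis HP : is_proC mul star S.
Hypothesis HX : is_hilbert_module mul star S act ip.
Let HA := proC_alg HP.
Implicit Types (p q : A -> R) (a b c : A) (x y z : X).

(** Because [d] at least halves at each step, the increments after [m] telescope to at most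
    [2 * d m], with the same rate for all seminorms. *)
Lemma hilbert_seq_complete (u : nat -> X) (d : nat -> R) :
  (forall m, 0 < d m) -> (forall m, d m.+1 <= d m / 2) ->
  (forall q, S q -> forall m, pbar ip q (u m.+1 - u m) <= d m) ->
  exists y, forall q, S q -> forall m, pbar ip q (y - u m) <= 2 * d m.
Proof.
move=> d0 dS hu.
have tail q m k : S q -> pbar ip q (u (m + k)%N - u m) <= 2 * d m - 2 * d (m + k)%N.
  move=> Sq; have Hf := hilbert_cs_form HP HX Sq.
  elim: k => [|k ih]; first by rewrite addn0 subrr (pbar0 Hf); lra.
  rewrite addnS.
  have -> : u (m + k).+1 - u m = (u (m + k).+1 - u (m + k)%N) + (u (m + k)%N - u m).
    by rewrite addrA subrK.
  apply: (le_trans (pbarD Hf _ _)).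
  by have := hu q Sq (m + k)%N; have := dS (m + k)%N; lra.
have small (e : R) : 0 < e -> exists N, forall m, (N <= m)%N -> 4 * d m < e.
  move=> e0.
  (* Halving yields [d m <= d 0 / (m + 1)], a crude rate that suffices for convergence to [0]. *)
  have hd m : d m * (m%:R + 1) <= d 0%N.
    elim: m => [|m ih]; first by rewrite add0r mulr1.
    have m0 : (0 : R) <= m%:R + 1 + 1 by rewrite !addr_ge0.
    rewrite -natr1; apply: (le_trans (ler_wpM2r m0 (dS m))).
    apply: le_trans ih; have := d0 m; have : (0 : R) <= m%:R by [].
    by move: (m%:R : R) (d m) => a b *; nra.
  exists (Num.bound (4 * d 0%N / e)) => m hm.
  have h : 4 * d 0%N / e < m%:R.
    apply: lt_le_trans (_ : (Num.bound (4 * d 0%N / e))%:R <= _); last by rewrite ler_nat.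
    by apply: archi_boundP; rewrite divr_ge0 ?mulr_ge0 // ltW.
  rewrite ltr_pdivrMr // in h; have := hd m; have := d0 m.
  have : (0 : R) <= m%:R by [].
  by move: (m%:R : R) (d m) h => *; nra.
pose F : set_system X := fun U => exists N, forall m, (N <= m)%N -> U (u m).
have FF : ProperFilter F.
  split; first by move=> [N h]; exact: (h N (leqnn N)).
  split.
  - by exists 0%N.
  - move=> U V [N h] [M h']; exists (maxn N M) => m.
    by rewrite geq_max => /andP[/h ? /h' ?].
  - by move=> U V UV [N h]; exists N => m /h /UV.
have [|y hy] := hilbert_complete HX FF.
  move=> p Sp e e0; have Hf := hilbert_cs_form HP HX Sp.
  have [N hN] := small e e0.
  exists [set x | pbar ip p (x - u N) <= 2 * d N].
    exists N => m hm /=; have := tail p N (m - N)%N Sp; rewrite subnKC //.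
    by have := d0 m; lra.
  move=> x z /= hx hz.
  have -> : x - z = (x - u N) - (z - u N) by rewrite opprB addrA subrK.
  apply: (le_lt_trans (pbarB Hf _ _)).
  by have := hN N (leqnn N); lra.
exists y => q Sq m; have Hf := hilbert_cs_form HP HX Sq.
apply: le_eps => e e0; have [U [N hN] hU] := hy q Sq e e0.
have := hU _ (hN (m + N)%N (leq_addl m N)); have := tail q m N Sq.
have -> : y - u m = (u (m + N)%N - u m) - (u (m + N)%N - y).
  by rewrite opprB [RHS]addrC addrA subrK.
have := pbarB Hf (u (m + N)%N - u m) (u (m + N)%N - y).
by have := d0 (m + N)%N; lra.
Qed.

(* Gliding hump: otherwise a series of uniformly small vectors [T x] with
   [pbar ip p x] large would converge to a vector outside the range. *)
Lemma bounded_below_of_surjective p (T T' : X -> X) : S p ->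
  (forall u v, T (u + v) = T u + T v) ->
  (forall (k : R[i]) u, T (k *: u) = k *: T u) ->
  (forall a u, T (act a u) = act a (T u)) ->
  is_adjoint ip T T' ->
  (forall y, exists x, T x = y) ->
  (forall x (e : R), 0 < e -> exists w, pbar ip p (x - T' w) < e) ->
  exists2 c : R, 0 < c & forall x, pbar ip p x <= c * pbar ip p (T x).
Proof.
move=> Sp TD TZ TA adjT surjT denseT'.
have Hf := hilbert_cs_form HP HX Sp; have Hp := proC_sn HP Sp.
apply: contrapT => nobound.
have T'Z (t : R) u : T' ((t%:C)%C *: u) = (t%:C)%C *: T' u.
  have linT' := adjoint_linear HP HX adjT.
  have T'0 : T' 0 = 0 by have := linT' (-1) 0 0; rewrite scaleN1r addNr scaleN1r addNr.
  by have := linT' (t%:C)%C u 0; rewrite !addr0 T'0 addr0.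
(* The vector is scaled to size [2 * M], with image of size at most [d / 2]. Mollifying with
   parameter [d ^+ 2] then moves it by at most [M / 2] and makes its image small for all
   seminorms. *)
have large (M d : R) : 0 < M -> 0 < d -> exists x,
    (forall q, S q -> pbar ip q (T x) <= d) /\ M <= pbar ip p x.
  move=> M0 d0; pose C := 4 * M / d; have C0 : 0 < C by rewrite !divr_gt0 ?mulr_gt0.
  have [x1 hx1] : exists x, C * pbar ip p (T x) < pbar ip p x.
    apply: contrapT => /forallNP h; apply: nobound; exists C => // x.
    by have /negP := h x; rewrite -leNgt.
  have nx1 : 0 < pbar ip p x1.
    by apply: le_lt_trans hx1; rewrite mulr_ge0 ?pbar_ge0 // ltW.
  pose t := 2 * M / pbar ip p x1; have t0 : 0 < t by rewrite divr_gt0 // mulr_gt0.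
  pose x := (t%:C)%C *: x1.
  have nx : pbar ip p x = 2 * M.
    by rewrite (pbarZ Hf) gtr0_norm // /t divfK // gt_eqF.
  have nTx : pbar ip p (T x) <= d / 2.
    rewrite /x TZ (pbarZ Hf) gtr0_norm //.
    have : C * (t * pbar ip p (T x1)) <= 2 * M.
      by rewrite -nx (pbarZ Hf) gtr0_norm // mulrCA ler_pM2l // ltW.
    rewrite -ler_pdivlMl // => h; apply: (le_trans h); rewrite /C.
    have -> : (4 * M / d)^-1 * (2 * M) = d / 2 by field; rewrite !gt_eqF.
    by [].
  have [x' [h1 h2]] := mollify HP HX x TD TZ TA (exprn_gt0 2 d0).
  exists x'; split=> [q Sq|].
    by apply: ler_of_sqr; [exact: ltW|exact: h1].
  have := h2 p Sp; rewrite nx; have := pbar_close Hf x x'; rewrite nx.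
  have : pbar ip p (T x) ^+ 2 <= d ^+ 2 / 4.
    by have := pbar_ge0 p ip (T x); nra.
  have d20 : 0 < d ^+ 2 by rewrite exprn_gt0.
  move: (d ^+ 2) d20 (pbar ip p (T x) ^+ 2) (pbar ip p (x - x')) => D D0 a b h3 h4 h5.
  have : D * b <= D * (M / 2) by nra.
  by rewrite ler_pM2l //; lra.
(* A state holds the partial sum, the tolerance for the next image and the index. The guard on the
   tolerance sits under the existential so that [choice] covers all states. *)
have step (s : X * R * nat) : exists xw : X * X, 0 < s.1.2 ->
    [/\ forall q, S q -> pbar ip q (T xw.1) <= s.1.2, pbar ip p (T' xw.2) <= 1 &
      pbar ip p s.1.1 + s.2%:R + 2 <= p (ip xw.1 (T' xw.2))].
  case: s => [[s d] m] /=.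
  have [d0|d0] := ltP 0 d; last by exists (0, 0).
  pose M := 2 * (pbar ip p s + m%:R + 2).
  have M0 : 0 < M.
    have := pbar_ge0 p ip s; have : (0 : R) <= m%:R by [].
    by rewrite /M; lra.
  have [x [hx1 hx2]] := large M d M0 d0; pose L := pbar ip p x.
  have L0 : 0 < L by exact: lt_le_trans hx2.
  have L40 : 0 < L / 4 by rewrite divr_gt0.
  have [w0 hw0] := denseT' x _ L40.
  (* [T' w0] has size at most [5 / 4 * L], so this normalises it to at most [1], while the pairing
     with [x] remains at least [3 / 5 * L], above [M / 2]. *)
  pose t := 4 / (5 * L); have t0 : 0 < t by rewrite divr_gt0 // mulr_gt0.
  have tL : t * L = 4 / 5 by rewrite /t; field; rewrite gt_eqF.
  exists (x, (t%:C)%C *: w0) => _ /=; split=> //.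
    rewrite T'Z (pbarZ Hf) gtr0_norm //.
    have := pbar_close Hf (T' w0) x; rewrite (pbarBC Hf) -/L => h.
    have : t * pbar ip p (T' w0) <= t * (5 / 4 * L) by rewrite ler_pM2l //; lra.
    by rewrite mulrCA tL; lra.
  rewrite T'Z (ipZr HP HX) (snZ Hp) gtr0_norm //.
  have h1 : 3 / 4 * L ^+ 2 <= p (ip x (T' w0)).
    have := sn_triangle Hp (ip x (T' w0)) (ip x (x - T' w0)).
    rewrite (ipBr HP HX) addrC subrK -(pbar_sqr Hf) -(ipBr HP HX) -/L => h.
    have := cs_ineq Hf x (x - T' w0); rewrite -/L; nra.
  have : t * (3 / 4 * L ^+ 2) <= t * p (ip x (T' w0)) by rewrite ler_pM2l.
  have -> : t * (3 / 4 * L ^+ 2) = t * L * (3 / 4 * L) by ring.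
  by rewrite tL; move: hx2; rewrite -/L /M; lra.
have [f hf] := choice step.
(* The factor [1 + pbar ip p xw.2] makes all later terms together contribute at most [1] when paired
   with the current [w]; the factor [2] gives the halving. *)
pose next (sd : X * R) m := let xw := f (sd, m) in
  (sd.1 + xw.1, sd.2 / (2 * (1 + pbar ip p xw.2))).
pose st := fix st m := if m is m'.+1 then next (st m') m' else (0, 1).
pose s m := (st m).1; pose d m := (st m).2.
pose x m := (f (st m, m)).1; pose w m := (f (st m, m)).2.
have sS m : s m.+1 = s m + x m by [].
have dS m : d m.+1 = d m / (2 * (1 + pbar ip p (w m))) by [].
have w0 m : 0 <= pbar ip p (w m) := pbar_ge0 _ _ _.
have d0 m : 0 < d m.
  elim: m => [|m ih]; first exact: ltr01.
  by rewrite dS divr_gt0 // mulr_gt0 //; have := w0 m; lra.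
have dw m : 2 * d m.+1 * (1 + pbar ip p (w m)) = d m.
  by rewrite dS; field; rewrite gt_eqF //; have := w0 m; lra.
have dS2 m : d m.+1 <= d m / 2.
  by have := dw m; have := w0 m; have := d0 m.+1; nra.
have d1 m : d m <= 1.
  elim: m => [|m ih]; first exact: lexx.
  by have := dS2 m; have := d0 m; lra.
have hst m := hf (st m, m) (d0 m).
have [|y hy] := @hilbert_seq_complete (fun m => T (s m)) d d0 dS2.
  move=> q Sq m; rewrite sS TD [T (s m) + _]addrC addrK.
  by have [h _ _] := hst m; exact: h.
have [z hz] := surjT y.
(* Paired with [T' (w m)], the preimage [z] of the limit splits into [s m], [x m] and a tail of size
   at most [1]; the size of [x m] then forces [z] to have seminorm at least [m]. *)
have hm m : m%:R <= pbar ip p z.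
  have [_ hw hx] := hst m; rewrite -/(x m) -/(w m) -/(s m) in hw hx.
  have xE : ip (x m) (T' (w m)) =
      (ip z (T' (w m)) - ip (s m) (T' (w m))) - ip (y - T (s m.+1)) (w m).
    rewrite (ipBl HX) -hz !adjT sS (ipDl HX) opprB addrC addrA subrK.
    by rewrite addrC addKr.
  have h1 := snB Hp (ip z (T' (w m)) - ip (s m) (T' (w m))) (ip (y - T (s m.+1)) (w m)).
  have h2 := snB Hp (ip z (T' (w m))) (ip (s m) (T' (w m))).
  have h3 := cs_ineq Hf z (T' (w m)); have h4 := cs_ineq Hf (s m) (T' (w m)).
  have h5 := cs_ineq Hf (y - T (s m.+1)) (w m); have h6 := hy p Sp m.+1.
  rewrite -xE in h1; have := pbar_ge0 p ip z; have := pbar_ge0 p ip (s m).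
  have h7 : pbar ip p (y - T (s m.+1)) * pbar ip p (w m) <= 1.
    apply: (@le_trans _ _ (2 * d m.+1 * pbar ip p (w m))); first exact: ler_wpM2r.
    by have := dw m; have := d1 m; have := d0 m.+1; lra.
  by rewrite /= in hx; move=> *; nra.
have := hm (Num.bound (pbar ip p z)); rewrite leNgt => /negP; apply.
exact/archi_boundP/pbar_ge0.
Qed.

End Surjective.

(** * Invertibility of [T] in the algebra of adjointable operators *)

Unset Implicit Arguments.

Theorem theorem4p12 (R : realType) (A : lmodType R[i]) (mul : A -> A -> A)
  (star : A -> A) (S : set (A -> R))
  (X : lmodType R[i]) (act : A -> X -> X) (ip : X -> X -> A)
  (K Kadj T Tadj : X -> X) (xi : nat -> X) :
  is_proC mul star S ->
  is_hilbert_module mul star S act ip ->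
  in_Hom_star S act ip K -> is_adjoint ip K Kadj ->
  unif_bounded S ip K -> dense_range S ip K ->
  K_frame mul star S ip Kadj xi ->
  in_Hom_star S act ip T -> is_adjoint ip T Tadj ->
  unif_bounded S ip T -> closed_range S ip T ->
  K_frame mul star S ip Kadj (fun i => T (xi i)) ->
  K_frame mul star S ip Kadj (fun i => Tadj (xi i)) ->
  exists Tinv : X -> X, [/\ in_Hom_star S act ip Tinv,
    forall x, T (Tinv x) = x & forall x, Tinv (T x) = x].
Proof.
move=> HP HX homK adjK bK denseK frame [TD TZ TA _ _] adjT [d d0 hT] closedT.
move=> frameT frameT'.
have Hf p (Sp : S p) := hilbert_cs_form HP HX Sp.
(* Symmetry of adjoints does not depend on the seminorm, so the zero seminorm serves. *)
have adjT' : is_adjoint ip Tadj T by exact: (adjoint_sym (Hf _ (S_zero HP)) adjT).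
have linT : linear T by move=> k x y; rewrite TD TZ.
have linT' : linear Tadj := adjoint_linear HP HX adjT.
have T'B u v : Tadj (u - v) = Tadj u - Tadj v.
  by rewrite [u - v]addrC [RHS]addrC -[- v]scaleN1r linT' scaleN1r.
have hT' p : S p -> forall x, pbar ip p (Tadj x) <= d * pbar ip p x.
  by move=> Sp; exact: (adjoint_bound (Hf p Sp) (ltW d0) adjT (hT p Sp)).
have denseKp p : S p -> forall x (e : R), 0 < e -> exists v, pbar ip p (x - K v) < e.
  move=> Sp x e e0.
  have [_ [v _ <-] hv] := (in_closureP ip HP _ _).1 (denseK x) p Sp e e0.
  by exists v.
have [c c0 hc] := frame_dominates HP HX adjT frame frameT.
have [c' c'0 hc'] := frame_dominates HP HX adjT' frame frameT'.
have denseT p : S p -> forall x (e : R), 0 < e -> exists u, pbar ip p (x - T u) < e.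
  move=> Sp; exact: (dense_of_dominated HP HX Sp linT adjT adjK d0 (hT p Sp) c0
    (hc p Sp) (denseKp p Sp)).
have denseT' p : S p -> forall x (e : R), 0 < e -> exists u, pbar ip p (x - Tadj u) < e.
  move=> Sp; exact: (dense_of_dominated HP HX Sp linT' adjT' adjK d0 (hT' p Sp) c'0
    (hc' p Sp) (denseKp p Sp)).
have surjT y : exists x, T x = y.
  have [|x _ <-] := closedT y; last by exists x.
  apply/(in_closureP ip HP) => p Sp e e0; have [u hu] := denseT p Sp y e e0.
  by exists (T u) => //; exists u.
have below p : S p -> exists2 b : R, 0 < b &
    forall x, pbar ip p x <= b * pbar ip p (T x).
  move=> Sp; exact: (bounded_below_of_surjective HP HX Sp TD TZ TA adjT surjT
    (denseT' p Sp)).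
have injT u v : T u = T v -> u = v.
  move=> uv; apply/eqP; rewrite -subr_eq0; apply/eqP/(pbar_eq0 HP HX) => p Sp.
  have [b b0 hb] := below p Sp; have := hb (u - v).
  have -> : T (u - v) = 0 by rewrite -scaleN1r TD TZ uv scaleN1r subrr.
  rewrite (pbar0 (Hf p Sp)) mulr0 => h; apply/le_anti/andP; split=> //.
  exact: pbar_ge0.
(* Writing [z = T v] gives [ip z z = ip v (Tadj z)] with [v] controlled by [z], so [Tadj] is bounded
   below by the same constant; dense range then gives surjectivity. *)
have surjT' y : exists x, Tadj x = y.
  apply: (solve_of_bounded_below HP HX T'B) => p Sp.
  - have [b b0 hb] := below p Sp; exists b => // z.
    have [v vz] := surjT z; have := hb v; rewrite vz => hv.
    have : pbar ip p z ^+ 2 <= b * pbar ip p (Tadj z) * pbar ip p z.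
      rewrite (pbar_sqr (Hf p Sp)) -{1}vz adjT.
      apply: (le_trans (cs_ineq (Hf p Sp) _ _)).
      by rewrite mulrAC; apply: ler_wpM2r => //; exact: pbar_ge0.
    have := pbar_ge0 p ip z; have := pbar_ge0 p ip (Tadj z) => h1 h2.
    have : 0 <= b * pbar ip p (Tadj z) by rewrite mulr_ge0 // ltW.
    by nra.
  - by exists d => // z; exact: hT'.
  - move=> e e0; have [u hu] := denseT' p Sp y e e0.
    by exists u; rewrite (pbarBC (Hf p Sp)).
have [Tinv hTinv] := choice surjT; have [Sinv hSinv] := choice surjT'.
exists Tinv; split=> //; last by move=> x; exact: injT.
split.
- by move=> x y; apply: injT; rewrite TD !hTinv.
- by move=> k x; apply: injT; rewrite TZ !hTinv.
- by move=> a x; apply: injT; rewrite TA !hTinv.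
(* A right inverse of [Tadj] is adjoint to [Tinv]: replace [y] by [Tadj (Sinv y)] and move [Tadj]
   across. *)
- by exists Sinv => x y; rewrite -{1}[y]hSinv -adjT hTinv.
- move=> p Sp; have [b b0 hb] := below p Sp; exists b; first exact: ltW.
  by move=> x; have := hb (Tinv x); rewrite hTinv.
Qed.
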